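(* Assume that $W$ is finite. For any $y,w\in\mathbf{I}_*$ such that $y\le w$ we have $$\sum_{t\in\mathbf{I}_*;\,y\le t\le w}\kappa(y)\kappa(t)P^\sigma_{y,t}P^{\sigma,\diamond}_{ww_S,tw_S}=\delta_{y,w}.$$
   Context: $W$ is a Coxeter group with set of simple reflections $S$, length function $l:W\to\mathbf{N}$ and Bruhat order $\le$. $w\mapsto w^*$ is an automorphism of $W$ with square $1$ which leaves $S$ stable. $\mathbf{I}_*=\{w\in W : (w^* )^{-1}=w\}$. $\delta_{x,y}$ is $1$ if $x=y$ and $0$ otherwise. $u$ is an indeterminate and $\mathcal{A}=\mathbf{Z}[u,u^{-1}]$. $\mathfrak{H}$ is the free $\mathcal{A}$-module with basis $(T_w)_{w\in W}$ with the unique $\mathcal{A}$-algebra structure with unit $T_1$ such that $T_wT_{w'}=T_{ww'}$ if $l(ww')=l(w)+l(w')$, and $(T_s+1)(T_s-u^2)=0$ for all $s\in S$. $\overline{\phantom{x}}:\mathfrak{H}\to\mathfrak{H}$ is the unique ring involution such that $\overline{u^nT_x}=u^{-n}T_{x^{-1}}^{-1}$ for $x\in W$, $n\in\mathbf{Z}$. $M$ is the free $\mathcal{A}$-module with basis $\{a_w : w\in\mathbf{I}_*\}$, with its unique $\mathfrak{H}$-module structure such that for $s\in S$, $w\in\mathbf{I}_*$: $T_s a_w = u a_w + (u+1)a_{sw}$ if $sw = ws^* > w$; $T_s a_w = (u^2-u-1)a_w + (u^2-u)a_{sw}$ if $sw = ws^* < w$; $T_s a_w = a_{sws^*}$ if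 $sw\ne ws^*$, $sw > w$; $T_s a_w = (u^2-1)a_w + u^2 a_{sws^*}$ if $sw\ne ws^*$, $sw < w$. $\overline{\phantom{x}}:M\to M$ is the unique $\mathbf{Z}$-linear map such that $\overline{hm}=\overline{h}\,\overline{m}$ for $h\in\mathfrak{H}$, $m\in M$ and $\overline{a_1}=a_1$. $v$ is an indeterminate, $\underline{\mathcal{A}}=\mathbf{Z}[v,v^{-1}]\supset\mathcal{A}$ via $u=v^2$. $\underline{M}=\underline{\mathcal{A}}\otimes_{\mathcal{A}}M$, and $\overline{\phantom{x}}$ is extended to $\underline{M}$ by $\overline{v^nm}=v^{-n}\overline{m}$ for $m\in M$, $n\in\mathbf{Z}$. For $w\in\mathbf{I}_*$, $A_w=v^{-l(w)}\sum_{y\in\mathbf{I}_*;\,y\le w}P^\sigma_{y,w}a_y\in\underline{M}$ (with $P^\sigma_{y,w}\in\mathbf{Z}[u]$) is the unique element of this form such that $\overline{A_w}=A_w$, $P^\sigma_{w,w}=1$ and $\deg P^\sigma_{y,w}\le(l(w)-l(y)-1)/2$ for all $y\in\mathbf{I}_*$, $y<w$. This defines the polynomials $P^\sigma_{y,w}$. $\phi:\mathbf{I}_*\to\mathbf{N}$ is the unique function such that $\phi(1)=0$ and for any $w\in\mathbf{I}_*$, $s\in S$ with $sw<w$ one has $\phi(w)=\phi(sw)+1$ if $sw=ws^*$ and $\phi(w)=\phi(sws^* )$ if $sw\ne ws^*$; one has $l(w)\equiv\phi(w)\bmod 2$ and $\kappa(w)=(-1)^{(l(w)+\phi(w))/2}$.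 $w_S$ is the longest element of the finite group $W$. $\diamond:W\to W$ is the involutive automorphism $x\mapsto w_Sx^*w_S=(w_Sxw_S)^*$, which leaves $S$ stable; $\mathbf{I}_\diamond=\{x\in W:(x^\diamond)^{-1}=x\}=\mathbf{I}_*w_S$. The polynomials $P^{\sigma,\diamond}_{x,z}\in\mathbf{Z}[u]$ ($x,z\in\mathbf{I}_\diamond$, $x\le z$) are those obtained from the definition of $P^\sigma_{y,w}$ by replacing $*$ by $\diamond$. *)

(* Defs.v *)
From HB Require Import structures.
From mathcomp Require Import all_boot all_order all_algebra all_fingroup.
From mathcomp Require Import boolp.

Set Implicit Arguments.
Unset Strict Implicit.
Unset Printing Implicit Defensive.

Import GRing.Theory.
Local Open Scope ring_scope.

(* -------------------------------------------------------------------------- *)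
(* Laurent polynomials.                                                       *)
(* [laurent k] is the subring Z[v^k, v^-k] of the fraction field of Z[v], so  *)
(* that the inclusion of Z[u, u^-1] in Z[v, v^-1] given by u = v^2 is literal.*)

Definition vfrac : {fraction {poly int}} := tofrac 'X.

Lemma vfracX_neq0 (n : nat) : vfrac ^+ n != 0.
Proof. by rewrite expf_neq0 // tofrac_eq0 polyX_eq0. Qed.

Definition in_laurent (k : nat) : {pred {fraction {poly int}}} :=
  fun x => `[< exists (p : {poly int}) (n : nat),
                 x = (map_poly intr p).[vfrac ^+ k] / (vfrac ^+ k) ^+ n >].

Lemma in_laurent_subring (k : nat) : subring_closed (in_laurent k).
Proof.
have t0 n : (vfrac ^+ k) ^+ n != 0 by rewrite -exprM vfracX_neq0.
have hX (n : nat) : (map_poly intr ('X^n : {poly int})).[vfrac ^+ k]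
    = (vfrac ^+ k) ^+ n by rewrite map_polyXn hornerXn.
split.
- apply/asboolP; exists 1, 0%N.
  by rewrite rmorph1 hornerC expr0 divr1.
- move=> x y /asboolP[p [n ->]] /asboolP[q [m ->]].
  apply/asboolP; exists (p * 'X^m - q * 'X^n), (n + m)%N.
  rewrite rmorphB !rmorphM /= hornerD hornerN !hornerM !hX exprD.
  by rewrite -mulNr addf_div // mulNr.
- move=> x y /asboolP[p [n ->]] /asboolP[q [m ->]].
  apply/asboolP; exists (p * q), (n + m)%N.
  by rewrite rmorphM hornerM exprD mulf_div.
Qed.

HB.instance Definition _ (k : nat) :=
  GRing.isSubringClosed.Build {fraction {poly int}} (in_laurent k)
    (in_laurent_subring k).

Record laurent (k : nat) : predArgType := Laurent {
  laurent_val : {fraction {poly int}};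
  laurent_valP : laurent_val \in in_laurent k
}.

HB.instance Definition _ (k : nat) := [isSub for @laurent_val k].
HB.instance Definition _ (k : nat) := [Choice of laurent k by <:].
HB.instance Definition _ (k : nat) :=
  [SubChoice_isSubComNzRing of laurent k by <:].

Definition laurent_unit (k : nat) : {pred laurent k} :=
  fun x => (x != 0) && ((val x)^-1 \in in_laurent k).

Definition laurent_inv (k : nat) (x : laurent k) : laurent k :=
  insubd x (val x)^-1.

Lemma laurent_val0 (k : nat) : val (0 : laurent k) = 0.
Proof. by []. Qed.

Lemma laurent_val1 (k : nat) : val (1 : laurent k) = 1.
Proof. by []. Qed.

Lemma laurent_valM (k : nat) (x y : laurent k) : val (x * y) = val x * val y.
Proof. by []. Qed.

Lemma laurent_valB (k : nat) (x y : laurent k) : val (x - y) = val x - val y.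
Proof. by []. Qed.

Lemma laurent_val_inv (k : nat) (x : laurent k) :
  (val x)^-1 \in in_laurent k -> val (laurent_inv x) = (val x)^-1.
Proof. by move=> xV; rewrite /laurent_inv val_insubd xV. Qed.

Lemma laurent_mulVr (k : nat) :
  {in @laurent_unit k, left_inverse 1 (@laurent_inv k) *%R}.
Proof.
move=> x /andP[x0 xV]; apply: val_inj.
rewrite laurent_valM (laurent_val_inv xV) mulVf; first by rewrite laurent_val1.
apply: contra_neq x0 => x0; apply: val_inj.
by rewrite x0 laurent_val0.
Qed.

Lemma laurent_unitPl (k : nat) (x y : laurent k) :
  y * x = 1 -> laurent_unit x.
Proof.
move=> yx1; have e : val y * val x = 1 by rewrite -laurent_valM yx1.
have x0 : val x != 0.
  by apply/eqP => x0; move: e; rewrite x0 mulr0 => /esym/eqP; rewrite oner_eq0.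
apply/andP; split; first by apply: contra_neq x0 => ->; rewrite laurent_val0.
have -> : (val x)^-1 = val y by rewrite -[LHS]mul1r -e mulfK.
exact: valP.
Qed.

Lemma laurent_inv_out (k : nat) :
  {in [predC @laurent_unit k], @laurent_inv k =1 id}.
Proof.
move=> x; rewrite inE /= unfold_in negb_and negbK.
case: (boolP ((val x)^-1 \in in_laurent k)) => [xV|xV _].
  rewrite orbF => /eqP x0; apply: val_inj.
  by rewrite (laurent_val_inv xV) x0 laurent_val0 invr0.
by apply: val_inj; rewrite val_insubd (negPf xV).
Qed.

HB.instance Definition _ (k : nat) :=
  GRing.ComNzRing_hasMulInverse.Build (laurent k)
    (@laurent_mulVr k) (@laurent_unitPl k) (@laurent_inv_out k).

Lemma laurent_var_subproof (k : nat) : vfrac ^+ k \in in_laurent k.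
Proof.
apply/asboolP; exists 'X, 0%N.
by rewrite map_polyX hornerX expr0 divr1.
Qed.

Definition laurent_var (k : nat) : laurent k :=
  Laurent (laurent_var_subproof k).

Lemma laurent_var_unit (k : nat) : laurent_var k \is a GRing.unit.
Proof.
suff h : (vfrac ^+ k)^-1 \in in_laurent k.
  apply/unitrPr; exists (Laurent h); apply: val_inj.
  by rewrite laurent_valM /= mulfV // vfracX_neq0.
apply/asboolP; exists 1, 1%N.
by rewrite rmorph1 hornerC expr1 mul1r.
Qed.

Notation Au := (laurent 2).
Notation Av := (laurent 1).
Notation u := (laurent_var 2).
Notation v := (laurent_var 1).

Lemma laurent_incl_subproof (x : Au) : val x \in in_laurent 1.
Proof.
case: x => x /= /asboolP[p [n ->]]; apply/asboolP.
exists (p \Po 'X^2), (2 * n)%N.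
by rewrite map_comp_poly horner_comp map_polyXn hornerXn expr1 -!exprM.
Qed.

Definition incl (x : Au) : Av := Laurent (laurent_incl_subproof x).

Lemma incl_is_zmod_morphism : zmod_morphism incl.
Proof. by move=> x y; apply: val_inj. Qed.

Lemma incl_is_monoid_morphism : monoid_morphism incl.
Proof.
by split=> [|x y]; apply: val_inj.
Qed.

HB.instance Definition _ :=
  GRing.isZmodMorphism.Build Au Av incl incl_is_zmod_morphism.
HB.instance Definition _ :=
  GRing.isMonoidMorphism.Build Au Av incl incl_is_monoid_morphism.

Lemma incl_u : incl u = v ^+ 2.
Proof. by apply: val_inj; rewrite expr2 laurent_valM /= expr1. Qed.

Definition Zu_to_Au (p : {poly int}) : Au := (map_poly intr p).[u].

(* [scale] is an argument because the module M below is only given as a       *)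
(* module over the Hecke algebra.                                             *)
Definition is_basis (I : finType) (D : {set I}) (R : nzRingType)
    (V : zmodType) (scale : R -> V -> V) (e : I -> V) : Prop :=
  (forall x : V, exists c : I -> R, x = \sum_(i in D) scale (c i) (e i)) /\
  (forall c : I -> R, \sum_(i in D) scale (c i) (e i) = 0 ->
     forall i, i \in D -> c i = 0).

(* -------------------------------------------------------------------------- *)
(* Finite Coxeter groups.                                                     *)

(* The universal property of the presentation                                 *)
(*   W = < S | (s t)^m(s,t) = 1 >,  m(s,t) = order of s t.                    *)
(* The case s = t gives the relations s^2 = 1.                                *)
Definition coxeter_system (W : finGroupType) (S : {set W}) : Prop :=
  [/\ (<<S>> = [set: W])%g,
      (forall s, s \in S -> #[s]%g = 2%N)
    & forall (G : groupType) (f : W -> G),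
        (forall s t, s \in S -> t \in S -> ((f s * f t) ^+ #[s * t] = 1)%g) ->
        exists g : W -> G,
          (forall x y, g (x * y)%g = (g x * g y)%g) /\ {in S, g =1 f}].

(* S ^+ n is the set of products of n elements of S. *)
Definition cox_length (W : finGroupType) (S : {set W}) (w : W) : nat :=
  match pselect (exists n : nat, w \in (S ^+ n)%g) with
  | left exn => ex_minn exn
  | right _ => 0%N
  end.

Definition reflections (W : finGroupType) (S : {set W}) : {set W} :=
  class_support S [set: W].

Definition bruhat (W : finGroupType) (S : {set W}) : rel W :=
  connect (fun x y => [exists t in reflections S, y == (x * t)%g]
                      && (cox_length S x < cox_length S y)%N).

Definition bruhat_lt (W : finGroupType) (S : {set W}) : rel W :=
  fun x y => (x != y) && bruhat S x y.

Definition longest (W : finGroupType) (S : {set W}) : W :=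
  [arg max_(x > 1%g) cox_length S x]%N.

Definition coxeter_involution (W : finGroupType) (S : {set W})
    (star : W -> W) : Prop :=
  [/\ {morph star : x y / (x * y)%g}, involutive star & star @: S = S].

Definition twisted_involutions (W : finGroupType) (star : W -> W) : {set W} :=
  [set w | ((star w)^-1 == w)%g].

Definition diamond (W : finGroupType) (S : {set W}) (star : W -> W) : W -> W :=
  fun x => (longest S * star x * longest S)%g.

(* -------------------------------------------------------------------------- *)
(* The Hecke algebra and its bar involution.                                  *)

Record heckeAlgebra (W : finGroupType) (S : {set W}) := HeckeAlgebra {
  hecke_sort :> unitAlgType Au;
  hT : W -> hecke_sort;
  hT_basis : is_basis [set: W] (fun k (h : hecke_sort) => k *: h) hT;
  hT_1 : hT 1%g = 1;
  hT_mul : forall x y,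
    cox_length S (x * y)%g = (cox_length S x + cox_length S y)%N ->
    hT x * hT y = hT (x * y)%g;
  hT_quadratic : forall s, s \in S -> (hT s + 1) * (hT s - (u ^+ 2)%:A) = 0;
  hbar : hecke_sort -> hecke_sort;
  hbar_add : {morph hbar : h h' / h + h'};
  hbar_mul : {morph hbar : h h' / h * h'};
  hbar_1 : hbar 1 = 1;
  hbar_invol : involutive hbar;
  hbar_T : forall (n : int) x,
    hbar (u ^ n *: hT x) = u ^ (- n) *: (hT x^-1%g)^-1
}.

(* -------------------------------------------------------------------------- *)
(* The H-module M with its bar operator. The basis a is only meaningful on    *)
(* twisted involutions, and scalars k in Z[u, u^-1] act on M through k%:A.    *)

Record involModule (W : finGroupType) (S : {set W}) (H : heckeAlgebra S)
    (star : W -> W) := InvolModule {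
  invol_sort :> lmodType H;
  ma : W -> invol_sort;
  ma_basis : is_basis (twisted_involutions star)
    (fun (k : Au) (m : invol_sort) => k%:A *: m) ma;
  ma_comm_up : forall s w, s \in S -> w \in twisted_involutions star ->
    (s * w = w * star s)%g -> bruhat_lt S w (s * w)%g ->
    hT H s *: ma w = u%:A *: ma w + (u + 1)%:A *: ma (s * w)%g;
  ma_comm_down : forall s w, s \in S -> w \in twisted_involutions star ->
    (s * w = w * star s)%g -> bruhat_lt S (s * w)%g w ->
    hT H s *: ma w =
      (u ^+ 2 - u - 1)%:A *: ma w + (u ^+ 2 - u)%:A *: ma (s * w)%g;
  ma_ncomm_up : forall s w, s \in S -> w \in twisted_involutions star ->
    (s * w)%g <> (w * star s)%g -> bruhat_lt S w (s * w)%g ->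
    hT H s *: ma w = ma (s * w * star s)%g;
  ma_ncomm_down : forall s w, s \in S -> w \in twisted_involutions star ->
    (s * w)%g <> (w * star s)%g -> bruhat_lt S (s * w)%g w ->
    hT H s *: ma w =
      (u ^+ 2 - 1)%:A *: ma w + (u ^+ 2)%:A *: ma (s * w * star s)%g;
  mbar : invol_sort -> invol_sort;
  mbar_add : {morph mbar : m m' / m + m'};
  mbar_act : forall (h : H) (m : invol_sort),
    mbar (h *: m) = hbar h *: mbar m;
  mbar_a1 : mbar (ma 1%g) = ma 1%g
}.

Definition semilinear_Au (W : finGroupType) (S : {set W})
    (H : heckeAlgebra S) (M : lmodType H) (N : lmodType Av)
    (f : M -> N) : Prop :=
  {morph f : m m' / m + m'} /\
  (forall (k : Au) (m : M), f (k%:A *: m) = incl k *: f m).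

(* The extension of scalars of M along incl, given by its universal property, *)
(* i.e. ext_in m is 1 (x) m.                                                  *)
Record extModule (W : finGroupType) (S : {set W}) (H : heckeAlgebra S)
    (star : W -> W) (M : involModule H star) := ExtModule {
  ext_sort :> lmodType Av;
  ext_in : M -> ext_sort;
  ext_in_semilinear : semilinear_Au ext_in;
  ext_univ : forall (N : lmodType Av) (f : M -> N), semilinear_Au f ->
    exists g : {linear ext_sort -> N},
      (forall m, g (ext_in m) = f m) /\
      (forall g' : {linear ext_sort -> N},
         (forall m, g' (ext_in m) = f m) -> g' =1 g);
  ebar : ext_sort -> ext_sort;
  ebar_add : {morph ebar : m m' / m + m'};
  ebar_in : forall (n : int) (m : M),
    ebar (v ^ n *: ext_in m) = v ^ (- n) *: ext_in (mbar m)
}.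

(* The element A_w attached to a family of candidates for P^sigma. *)
Definition canonical_elt (W : finGroupType) (S : {set W})
    (H : heckeAlgebra S) (star : W -> W) (M : involModule H star)
    (E : extModule M) (P : W -> W -> {poly int}) (w : W) : E :=
  v ^ (- (cox_length S w)%:Z) *:
    \sum_(y in twisted_involutions star | bruhat S y w)
       incl (Zu_to_Au (P y w)) *: ext_in E (ma M y).

(* With (size p).-1 the degree of p, the degree condition reads               *)
(* 2 deg P y w <= l(w) - l(y) - 1, where l(y) < l(w); it holds for P y w = 0. *)
Definition is_Psigma (W : finGroupType) (S : {set W})
    (H : heckeAlgebra S) (star : W -> W) (M : involModule H star)
    (E : extModule M) (P : W -> W -> {poly int}) : Prop :=
  forall w, w \in twisted_involutions star ->
  [/\ ebar (canonical_elt E P w) = canonical_elt E P w,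
      P w w = 1
    & forall y, y \in twisted_involutions star -> bruhat_lt S y w ->
        (2 * (size (P y w)).-1 <= cox_length S w - cox_length S y - 1)%N].

(* -------------------------------------------------------------------------- *)

Definition is_phi (W : finGroupType) (S : {set W}) (star : W -> W)
    (phi : W -> nat) : Prop :=
  phi 1%g = 0%N /\
  (forall w s, w \in twisted_involutions star -> s \in S ->
     bruhat_lt S (s * w)%g w ->
     ((s * w = w * star s)%g -> phi w = (phi (s * w)%g).+1) /\
     ((s * w)%g <> (w * star s)%g -> phi w = phi (s * w * star s)%g)).

(* Halving is exact: l(w) + phi(w) is even for w a twisted involution.        *)
Definition kappa (W : finGroupType) (S : {set W}) (phi : W -> nat)
    (w : W) : {poly int} :=
  (-1) ^+ ((cox_length S w + phi w)./2).

(* Main.v *)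
(** Write w0 for the longest element. Pair M with the diamond module by
    <a_x, a_(z w0)> = kappa(x) delta_(x,z), bilinearly over Z[u, u^-1]. Checking
    the action formulas gives <T_s m, n> = <m, -u^2 T_s^-1 n>. Hence both
    <bar m, bar n> and bar <m, n> transform in the same way under the Hecke
    algebra, and since M is generated by a_1 up to the factors u + 1, the
    identity u^l(w0) <bar m, bar n> = bar <m, n> follows from the case m = a_1,
    which says that the bar operator of the diamond module is triangular with
    coefficient u^-l(w0) at w0.
    For m = sum_y P_(y,w) a_y and n = sum_x Pd_(x,z w0) a_x the bar identity
    becomes X = u^(l(w) - l(z)) bar X, where X is the polynomial
    sum_(z <= t <= w) kappa(t) P_(t,w) Pd_(t w0,z w0), of degree less than
    (l(w) - l(z)) / 2 when z < w; hence X = 0. The theorem is this identity with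
    the two matrices multiplied in the other order. *)

Require Import Defs.
From HB Require Import structures.
From mathcomp Require Import all_boot all_order all_algebra all_fingroup.
From mathcomp Require Import boolp zify ring.

Set Implicit Arguments.
Unset Strict Implicit.
Unset Printing Implicit Defensive.

Import GRing.Theory.

(** * Length and Bruhat order *)

Section Length.
Local Open Scope group_scope.
Local Open Scope nat_scope.
Context (W : finGroupType) (S : {set W}).
Hypothesis genS : (<<S>> = [set: W])%g.
Hypothesis ordS : forall s, s \in S -> #[s]%g = 2.
Notation len := (cox_length S).
Implicit Types (s x y t : W).

Lemma simpleK s : s \in S -> (s * s = 1)%g.
Proof. by move=> /ordS os; rewrite -[RHS](expg_order s) os expgS expg1. Qed.

Lemma simpleV s : s \in S -> (s^-1 = s)%g.
Proof.
by move=> /simpleK ss; rewrite -[RHS]mulg1 -(mulgV s) mulgA ss mul1g.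
Qed.

Lemma word_exists x : exists n, x \in (S ^+ n)%g.
Proof.
have : x \in <<S>>%g by rewrite genS inE.
case/gen_prodgP=> n [c cS ->]; exists n.
elim: n c cS => [|n IHn] c cS; first by rewrite big_ord0 expg0 set11.
by rewrite big_ord_recl expgS mem_mulg // IHn.
Qed.

Lemma mem_exp_len x : x \in (S ^+ len x)%g.
Proof.
rewrite /cox_length; case: pselect => [e|/(_ (word_exists x))//].
by case: ex_minnP.
Qed.

Lemma len_le_exp n x : x \in (S ^+ n)%g -> len x <= n.
Proof.
move=> xn; rewrite /cox_length; case: pselect => [e|/(_ (word_exists x))//].
by case: ex_minnP => m _ /(_ n xn).
Qed.

Lemma len1 : len 1%g = 0.
Proof. by apply/eqP; rewrite -leqn0 len_le_exp // expg0 set11. Qed.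

Lemma len0 x : len x = 0 -> x = 1%g.
Proof. by move=> e; have := mem_exp_len x; rewrite e expg0 => /set1P. Qed.

Lemma lenS s x : s \in S -> len (s * x)%g <= (len x).+1.
Proof. by move=> sS; rewrite len_le_exp // expgS mem_mulg ?mem_exp_len. Qed.

Lemma len_split n x : len x = n.+1 ->
  exists s y, [/\ s \in S, x = (s * y)%g & len y = n].
Proof.
move=> e; have := mem_exp_len x; rewrite e expgS => /mulsgP[s y sS yn xE].
exists s, y; split=> //; apply/eqP; rewrite eqn_leq len_le_exp //=.
by rewrite -ltnS -e xE lenS.
Qed.

Lemma len_ind (Q : W -> Prop) : Q 1%g ->
  (forall s x, s \in S -> len (s * x)%g = (len x).+1 -> Q x -> Q (s * x)%g) ->
  forall x, Q x.
Proof.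
move=> Q1 QS x; have [n] := ubnP (len x); elim: n x => // n IHn x ltn.
case e : (len x) => [|k]; first by rewrite (len0 e).
have [s [y [sS xE yk]]] := len_split e.
by rewrite xE; apply: QS; rewrite // -?xE ?e ?yk //; apply: IHn; lia.
Qed.

Lemma memV_expS n x : x \in (S ^+ n)%g -> x^-1%g \in (S ^+ n)%g.
Proof.
elim: n x => [|n IHn] x.
  by rewrite expg0 => /set1P->; rewrite invg1 set11.
rewrite expgS => /mulsgP[s y sS yn ->].
by rewrite invMg (simpleV sS) -(expgS S n) expgSr mem_mulg // IHn.
Qed.

Lemma lenV x : len x^-1%g = len x.
Proof.
have le z : len z^-1%g <= len z by apply/len_le_exp/memV_expS/mem_exp_len.
by apply/eqP; rewrite eqn_leq le -{1}[x]invgK le.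
Qed.

Lemma reflectionP t :
  reflect (exists s g, s \in S /\ t = (g * s * g^-1)%g) (t \in reflections S).
Proof.
apply: (iffP idP) => [/imset2P[s g sS _ ->]|[s [g [sS ->]]]].
  by exists s, g^-1%g; split=> //; rewrite invgK conjgE mulgA.
have -> : (g * s * g^-1 = s ^ g^-1)%g by rewrite conjgE invgK mulgA.
by rewrite memJ_class_support ?inE.
Qed.

Lemma simple_reflection s : s \in S -> s \in reflections S.
Proof.
move=> sS; apply/reflectionP; exists s, 1%g; split=> //.
by rewrite mul1g invg1 mulg1.
Qed.

Lemma reflectionK t : t \in reflections S -> (t * t = 1)%g.
Proof.
move=> /reflectionP[s [g [sS ->]]].
by rewrite -!mulgA mulKg (mulgA s s) simpleK // mul1g mulgV.
Qed.

Lemma reflectionJ g t :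
  (g * t * g^-1)%g \in reflections S = (t \in reflections S).
Proof.
apply/reflectionP/reflectionP => -[s [h [sS e]]].
  exists s, (g^-1 * h)%g; split=> //.
  have -> : (t = g^-1 * (g * t * g^-1) * g)%g.
    by rewrite -!mulgA mulKg mulVg mulg1.
  by rewrite e invMg invgK !mulgA.
by exists s, (g * h)%g; split=> //; rewrite e invMg !mulgA.
Qed.

End Length.

(** * Inversion sets, obtained from the presentation *)

Section Inversions.
Local Open Scope nat_scope.
Context (W : finGroupType) (S : {set W}).
Hypothesis hW : coxeter_system S.
Notation len := (cox_length S).
Implicit Types (s x y t : W).

Let genS : (<<S>> = [set: W])%g. Proof. by case: hW. Qed.
Let ordS s : s \in S -> #[s]%g = 2. Proof. by case: hW => _ + _; apply. Qed.

(** Subsets of [W] are encoded as boolean functions, with symmetric difference as [(+)]. *)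
Definition affine_fun s (A : {ffun W -> bool}) : {ffun W -> bool} :=
  [ffun r => (r == s) (+) A (s^-1 * r * s)%g].

Lemma affine_fun_inj s : injective (affine_fun s).
Proof.
move=> A B /ffunP AB; apply/ffunP => r.
have := AB (s * r * s^-1)%g; rewrite !ffunE.
have -> : (s^-1 * (s * r * s^-1) * s = r)%g.
  by rewrite -!mulgA mulKg mulVg mulg1.
by move/addbI.
Qed.

Definition affine_perm s : {perm {ffun W -> bool}} := perm (@affine_fun_inj s).

(** Each round adds two reflections of the dihedral group generated by [s] and [t]. Permutations
    compose from left to right, so [s] acts first and the rotation that appears is [t * s]. *)
Lemma affine_iter s t n (A : {ffun W -> bool}) r : s \in S -> t \in S ->
  (((affine_perm s * affine_perm t) ^+ n)%g A) r =
  (\big[addb/false]_(j < 2 * n) (r == (t * s) ^+ j * t)%g)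
    (+) A ((t * s) ^- n * r * (t * s) ^+ n)%g.
Proof.
move=> sS tS; elim: n A r => [|n IHn] A r.
  by rewrite muln0 big_ord0 !expg0 perm1 mulg1 invg1 mul1g.
rewrite expgSr permM permM !permE /= !ffunE IHn; set c := (t * s)%g.
have [sV tV] : (s^-1 = s)%g /\ (t^-1 = t)%g by rewrite !(simpleV ordS).
have cV : (c^-1 = s * t)%g by rewrite invMg sV tV.
have ct : (c * t = t * c^-1)%g by rewrite cV mulgA.
have cE : c = (t * s)%g by [].
clearbody c.
have rJ : (s^-1 * (t^-1 * r * t) * s = c^-1 * r * c)%g.
  by rewrite cV sV tV cE !mulgA.
(* Conjugation by [c] takes [c ^+ j * t] to [c ^+ j.+2 * t], because [t] inverts [c]. *)
have rc j : ((s^-1 * (t^-1 * r * t) * s)%g == (c ^+ j * t)%g)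
    = (r == c ^+ j.+2 * t)%g.
  rewrite -(inj_eq (mulgI c)) -(inj_eq (mulIg c^-1%g)); congr (_ == _).
    by rewrite rJ !mulgA mulgV mul1g mulgK.
  by rewrite (expgS c j.+1) (expgSr c j) -!mulgA ct.
rewrite mulnS !big_ord_recl /= expg0 mul1g.
rewrite -!addbA; congr (_ (+) (_ (+) (_ (+) _))).
- rewrite -(inj_eq (mulgI t)) -(inj_eq (mulIg t^-1%g)) /bump /= addn0 expg1.
  have -> : (t * (t^-1 * r * t) * t^-1 = r)%g.
    by rewrite !mulgA mulgV mul1g mulgK.
  by rewrite tV -cE.
- by apply: eq_bigr => j _; rewrite rc.
- by rewrite rJ (expgS c n) invMg !mulgA.
Qed.

(** With n the order of [t * s], the 2n reflections of the iterate fall into two equal halves, which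
    cancel modulo 2. *)
Lemma affine_relation s t : s \in S -> t \in S ->
  ((affine_perm s * affine_perm t) ^+ #[s * t])%g = 1%g.
Proof.
move=> sS tS; apply/permP => A; apply/ffunP => r; rewrite affine_iter // perm1.
have -> : #[s * t]%g = #[t * s]%g.
  by rewrite -orderV invMg !(simpleV ordS).
rewrite expg_order invg1 mul1g mulg1 mul2n -addnn big_split_ord /=.
set a := \big[_/_]_(_ < _) _; set b := \big[_/_]_(_ < _) _.
suff -> : b = a by rewrite addbb.
by apply: eq_bigr => j _; rewrite expgD expg_order mul1g.
Qed.

(* [N x r] says that the reflection r is an inversion of x; the cocycle rule is
   the group law of the affine action A |-> {s} + s A s of W on sets. *)
Lemma inversion_cocycle : exists N : W -> W -> bool,
  (forall s r, s \in S -> N s r = (r == s)) /\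
  (forall x y r, N (x * y)%g r = N x r (+) N y (x^-1 * r * x)%g).
Proof.
have [_ _ univ] := hW.
have [g [gM gS]] := univ _ affine_perm affine_relation.
pose z : {ffun W -> bool} := [ffun=> false].
have g1 : g 1%g = 1%g by apply: (mulgI (g 1%g)); rewrite -gM !mulg1.
(* The map attached to [x^-1] is affine: its linear part is conjugation, its translation part is its
   value at the empty set. *)
have gA x A r : g x^-1%g A r = g x^-1%g z r (+) A (x^-1 * r * x)%g.
  move: x A r; apply: (len_ind genS) => [A r|s x sS _ IHx A r].
    by rewrite invg1 g1 !perm1 ffunE mul1g mulg1.
  rewrite invMg gM !permM (simpleV ordS sS) gS // !permE !ffunE IHx.
  by rewrite (simpleV ordS sS) -addbA !mulgA.
(* The inverse compensates for the left-to-right composition of permutations. *)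
exists (fun x r => g x^-1%g z r); split=> [s r sS|x y r].
  by rewrite (simpleV ordS sS) gS // permE !ffunE addbF.
by rewrite invMg gM permM (gA x (g y^-1%g z)).
Qed.

End Inversions.

Section Exchange.
Local Open Scope nat_scope.
Context (W : finGroupType) (S : {set W}) (N : W -> W -> bool).
Hypothesis genS : (<<S>> = [set: W])%g.
Hypothesis ordS : forall s, s \in S -> #[s]%g = 2.
Hypothesis NS : forall s r, s \in S -> N s r = (r == s).
Hypothesis NM : forall x y r, N (x * y)%g r = N x r (+) N y (x^-1 * r * x)%g.
Notation len := (cox_length S).
Implicit Types (s x y t r : W).

Lemma inv1 r : N 1%g r = false.
Proof. by have := NM 1%g 1%g r; rewrite invg1 !mul1g mulg1 addbb. Qed.

Lemma invV x r : N x^-1%g r = N x (x * r * x^-1)%g.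
Proof.
have := NM x^-1%g x r; rewrite mulVg inv1 invgK.
by case: (N x^-1%g r); case: (N x _).
Qed.

Lemma invS s x r : s \in S -> N (s * x)%g r = (r == s) (+) N x (s * r * s)%g.
Proof. by move=> sS; rewrite NM NS // (simpleV ordS). Qed.

Lemma inv_reflection x r : N x r -> r \in reflections S.
Proof.
move: x r; apply: (len_ind genS) => [r|s x sS _ IHx r]; first by rewrite inv1.
rewrite invS //; case: eqP => [-> _|_ /IHx]; first exact: simple_reflection.
by rewrite -{2}(simpleV ordS sS) reflectionJ.
Qed.

(** For [t] the conjugate of [s] by [g], the cocycle rule yields the contribution of [s] at itself,
    which is 1, and those of [g] and [g^-1], which are equal and cancel. *)
Lemma inv_self t : t \in reflections S -> N t t.
Proof.
move=> /reflectionP[s [g [sS ->]]].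
rewrite NM NM invV (NS _ sS) invMg (simpleV ordS sS).
set t' := (g * s * g^-1)%g.
have -> : (g^-1 * t' * g = s)%g by rewrite /t' -!mulgA mulKg mulVg mulg1.
have -> : (g * (s * g^-1 * t' * (g * s)) * g^-1 = t')%g.
  by rewrite /t' -!mulgA !mulKg (mulgA s s) (simpleK ordS) // mul1g.
by rewrite eqxx addbT; case: (N g t').
Qed.

Lemma inv_len_lt x t : N x t -> len (t * x)%g < len x.
Proof.
move: x t; apply: (len_ind genS) => [t|s x sS e IHx t]; first by rewrite inv1.
rewrite e invS //; case: eqP => [-> _|_ /= /IHx lt].
  by rewrite mulgA (simpleK ordS) // mul1g.
have -> : (t * (s * x) = s * (s * t * s * x))%g.
  by rewrite !mulgA (simpleK ordS) // mul1g.
by have := lenS genS (s * t * s * x)%g sS; lia.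
Qed.

(** For the converse of [inv_len_lt]: if [t] is not an inversion of [x], the cocycle rule and
    [inv_self] make it one of [t * x], so multiplying by [t] again shortens. *)
Lemma invE x t : t \in reflections S -> N x t = (len (t * x)%g < len x).
Proof.
move=> tR; apply/idP/idP => [/inv_len_lt //|].
have tt := reflectionK ordS tR.
apply: contraTT => nN; rewrite -leqNgt ltnW //.
have xE : x = (t * (t * x))%g by rewrite mulgA tt mul1g.
by rewrite [X in len X < _]xE inv_len_lt // NM inv_self // mulVg mul1g.
Qed.

End Exchange.

(** * Lengths, the longest element and Bruhat order *)

Section Coxeter.
Local Open Scope nat_scope.
Context (W : finGroupType) (S : {set W}).
Hypothesis hW : coxeter_system S.
Notation len := (cox_length S).
Notation w0 := (longest S).
Implicit Types (s x y t r w : W).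

Let genS : (<<S>> = [set: W])%g. Proof. by case: hW. Qed.
Let ordS s : s \in S -> #[s]%g = 2. Proof. by case: hW => _ + _; apply. Qed.

Lemma len_reflection_neq x t : t \in reflections S -> len (t * x)%g != len x.
Proof.
move=> tR; have [N [NS NM]] := inversion_cocycle hW.
have NE := invE genS ordS NS NM.
have := NE x t tR; have := NE (t * x)%g t tR.
rewrite NM (inv_self ordS NS NM tR) mulgA (reflectionK ordS) // mulVg !mul1g.
by case: (N x t) => /=; lia.
Qed.

Lemma len_simple s x : s \in S ->
  len (s * x)%g = (len x).+1 \/ len x = (len (s * x)%g).+1.
Proof.
move=> sS; have := len_reflection_neq x (simple_reflection sS).
have := lenS genS x sS; have := lenS genS (s * x)%g sS.
by rewrite mulgA (simpleK ordS) // mul1g; lia.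
Qed.

(** Here [s] is not an inversion of [x], and the cocycle rule makes it one of [x * s'] only if
    [x^-1 * s * x = s'], which is excluded. *)
Lemma len_exchange s s' x : s \in S -> s' \in S -> (s * x)%g <> (x * s')%g ->
  len x < len (s * x)%g -> len x < len (x * s')%g ->
  len (s * x * s')%g = (len x).+2.
Proof.
move=> sS s'S ne lt1 lt2; have [N [NS NM]] := inversion_cocycle hW.
have NE := invE genS ordS NS NM.
have sN : N x s = false.
  by rewrite NE ?simple_reflection //; apply/negbTE; rewrite -leqNgt ltnW.
have : N (x * s')%g s = false.
  rewrite NM sN (NS _ _ s'S); apply/eqP => e; apply: ne.
  by rewrite -e !mulgA mulgV mul1g.
rewrite NE ?simple_reflection //.
have := len_simple x sS; have := len_simple (x * s')%g sS.
have := lenS genS x^-1%g s'S.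
have -> : len (s' * x^-1)%g = len (x * s')%g.
  by rewrite -(lenV genS ordS (x * s')) invMg (simpleV ordS s'S).
rewrite (lenV genS ordS) mulgA => h1 h2 _ h4; move: h1 h2 h4 lt2.
move: (len _) (len _) (len _) => a b c; lia.
Qed.

(** Along a reduced word, a new first letter [s] conjugates the earlier inversions by [s] and adds
    [s] itself. *)
Lemma card_inversions (N : W -> W -> bool) :
    (forall s r, s \in S -> N s r = (r == s)) ->
    (forall x y r, N (x * y)%g r = N x r (+) N y (x^-1 * r * x)%g) ->
  forall x, #|[set r | N x r]| = len x.
Proof.
move=> NS NM; apply: (len_ind genS) => [|s x sS e IHx].
  by rewrite len1 //; apply/eqP; rewrite cards_eq0; apply/eqP/setP => r;
     rewrite !inE (inv1 NM).
have sN : N x s = false.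
  by rewrite (invE genS ordS NS NM) ?simple_reflection //; lia.
have ss := simpleK ordS sS.
pose c r := (s * r * s)%g.
have cK : involutive c by move=> r; rewrite /c !mulgA ss mul1g -mulgA ss mulg1.
have cN r : (r \in c @: [set r | N x r]) = N x (c r).
  by rewrite -{1}(cK r) mem_imset ?inE //; exact: inv_inj.
rewrite e; have <- : #|c @: [set r | N x r]| = len x.
  by rewrite card_imset //; exact: inv_inj.
have -> : [set r | N (s * x)%g r] = s |: c @: [set r | N x r].
  apply/setP => r; rewrite in_setU1 cN inE (invS ordS NS NM _ _ sS) -/(c r).
  by case: eqP => // ->; rewrite /c ss mul1g sN.
by rewrite cardsU1 cN /c ss mul1g sN.
Qed.

Lemma len_longest x : len x <= len w0.
Proof. by rewrite /longest; case: arg_maxnP => // w _; apply. Qed.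

(** By maximality every reflection is an inversion of [w0]. Hence the inversions of [x * w0] are the
    reflections that are not inversions of [x]. *)
Lemma len_mul_longest x : len (x * w0)%g = len w0 - len x.
Proof.
have [N [NS NM]] := inversion_cocycle hW.
have NE := invE genS ordS NS NM.
have N0 r : N w0 r = (r \in reflections S).
  apply/idP/idP => [|rR]; first exact: inv_reflection.
  rewrite NE // ltn_neqAle len_longest andbT; exact: len_reflection_neq.
rewrite -!(card_inversions NS NM).
have -> : [set r | N (x * w0)%g r] = [set r | N w0 r] :\: [set r | N x r].
  apply/setP => r; rewrite !inE NM !N0.
  have -> : ((x^-1 * r * x)%g \in reflections S) = (r \in reflections S).
    by rewrite -{2}[x]invgK reflectionJ.
  have := @inv_reflection _ _ _ genS ordS NS NM x r.
  by case: (N x r) => // /(_ isT) ->.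
rewrite cardsD (setIidPr _) //; apply/subsetP => r; rewrite !inE N0.
exact: inv_reflection.
Qed.

Lemma longest_unique x : len x = len w0 -> (x * w0 = 1)%g.
Proof. by move=> e; apply: (len0 genS); rewrite len_mul_longest e subnn. Qed.

Lemma longestK : (w0 * w0 = 1)%g.
Proof. exact: longest_unique. Qed.

Lemma longestV : (w0^-1 = w0)%g.
Proof. by rewrite -[RHS]mulg1 -(mulgV w0) mulgA longestK mul1g. Qed.

Lemma bruhat_len x y : bruhat S x y -> x = y \/ len x < len y.
Proof.
case/connectP => p; elim: p x => [|z p IHp] x /=; first by move=> _ ->; left.
case/andP => /andP[_ lt] /IHp IH /IH[<-|lt2]; first by right.
by right; apply: ltn_trans lt2.
Qed.

Lemma bruhat_lt_len x y : bruhat_lt S x y -> len x < len y.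
Proof. by case/andP => ne /bruhat_len[e|//]; rewrite e eqxx in ne. Qed.

Lemma bruhat_simple s x : s \in S ->
  bruhat_lt S x (s * x)%g = (len x < len (s * x)%g).
Proof.
move=> sS; apply/idP/idP => [/bruhat_lt_len//|lt]; apply/andP; split.
  by apply: contraTneq lt => <-; rewrite ltnn.
apply: connect1; rewrite lt andbT; apply/existsP; exists (x^-1 * s * x)%g.
rewrite !mulgA mulgV mul1g eqxx andbT -{2}[x]invgK reflectionJ //.
exact: simple_reflection.
Qed.

(** An edge [c = a * t] gives an edge from [c * w0] to [a * w0] through the reflection
    [w0 * t * w0^-1]. *)
Lemma bruhat_mul_longest x y : bruhat S (x * w0)%g (y * w0)%g = bruhat S y x.
Proof.
suff h a b : bruhat S a b -> bruhat S (b * w0)%g (a * w0)%g.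
  apply/idP/idP => /h //.
  by rewrite -!mulgA longestK !mulg1.
case/connectP => p; elim: p a => [|c p IHp] a /=.
  by move=> _ ->; exact: connect0.
case/andP => /andP[/existsP[t /andP[tR /eqP e]] lt] /IHp IH /IH h1.
apply: connect_trans h1 (connect1 _).
rewrite !len_mul_longest; apply/andP; split; last first.
  by have := len_longest c; lia.
apply/existsP; exists (w0 * t * w0^-1)%g; rewrite reflectionJ // tR e /=.
rewrite longestV !mulgA -(mulgA _ w0 w0) longestK mulg1 -(mulgA a).
by rewrite (reflectionK ordS) // mulg1.
Qed.

End Coxeter.

(** * Twisted involutions *)

Section Twisted.
Local Open Scope nat_scope.
Context (W : finGroupType) (S : {set W}) (star : W -> W).
Hypotheses (hW : coxeter_system S) (hstar : coxeter_involution S star).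
Notation len := (cox_length S).
Notation w0 := (longest S).
Notation I := (twisted_involutions star).
Implicit Types (s x y t r w : W).

Let genS : (<<S>> = [set: W])%g. Proof. by case: hW. Qed.
Let ordS s : s \in S -> #[s]%g = 2. Proof. by case: hW => _ + _; apply. Qed.
Let starM : {morph star : x y / (x * y)%g}. Proof. by case: hstar. Qed.
Let starK : involutive star. Proof. by case: hstar. Qed.

Lemma star_simple s : s \in S -> star s \in S.
Proof. by move=> sS; have [_ _ <-] := hstar; exact: imset_f. Qed.

Lemma star1 : star 1%g = 1%g.
Proof. by apply: (mulgI (star 1%g)); rewrite -starM !mulg1. Qed.

Lemma star_len x : len (star x) = len x.
Proof.
have le y : len (star y) <= len y.
  move: y; apply: (len_ind genS) => [|s x' sS e IH]; first by rewrite star1.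
  by rewrite starM e; have := lenS genS (star x') (star_simple sS); lia.
by apply/eqP; rewrite eqn_leq le -{1}[x]starK le.
Qed.

Lemma star_longest : star w0 = w0.
Proof.
have := longest_unique hW (star_len w0).
by rewrite -(longestK hW) => /mulIg.
Qed.

Lemma twistedP w : reflect (star w = w^-1)%g (w \in I).
Proof.
by rewrite inE; apply: (iffP eqP) => [{2}<-|->]; rewrite invgK.
Qed.

Lemma twisted1 : 1%g \in I.
Proof. by apply/twistedP; rewrite star1 invg1. Qed.

Lemma twisted_comm s w : s \in S -> w \in I -> (s * w = w * star s)%g ->
  (s * w)%g \in I.
Proof.
move=> sS /twistedP wI e; apply/twistedP.
by rewrite {2}e invMg starM wI (simpleV ordS (star_simple sS)).
Qed.

Lemma twisted_conj s w : s \in S -> w \in I -> (s * w * star s)%g \in I.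
Proof.
move=> sS /twistedP wI; apply/twistedP.
rewrite !starM wI starK !invMg (simpleV ordS sS).
by rewrite (simpleV ordS (star_simple sS)) mulgA.
Qed.

(** For a twisted involution, [w * star s] is the inverse of [star (s * w)]. *)
Lemma len_mulr_star s w : s \in S -> w \in I ->
  len (w * star s)%g = len (s * w)%g.
Proof.
move=> sS /twistedP wI; rewrite -(lenV genS ordS) invMg -wI.
by rewrite (simpleV ordS (star_simple sS)) -starM star_len.
Qed.

Lemma len_conj s w : s \in S -> w \in I -> (s * w)%g <> (w * star s)%g ->
  len w < len (s * w)%g -> len (s * w * star s)%g = (len w).+2.
Proof.
move=> sS wI ne lt; apply: len_exchange; rewrite ?star_simple //.
by rewrite len_mulr_star.
Qed.

Lemma twisted_longest w :
  ((w * w0)%g \in twisted_involutions (diamond S star)) = (w \in I).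
Proof.
rewrite !inE /diamond starM star_longest.
rewrite -mulgA -(mulgA (star w)) longestK // mulg1 invMg (longestV hW).
by rewrite (inj_eq (mulIg w0)).
Qed.

Lemma mul_longest_diamond s w :
  (w * w0 * diamond S star s = w * star s * w0)%g.
Proof. by rewrite /diamond !mulgA -(mulgA w) longestK // mulg1. Qed.

End Twisted.

Local Open Scope ring_scope.

(** * The bar involution on scalars *)

Lemma laurent_val_zmod_morphism k : zmod_morphism (@laurent_val k).
Proof. by []. Qed.

Lemma laurent_val_monoid_morphism k : monoid_morphism (@laurent_val k).
Proof. by []. Qed.

HB.instance Definition _ k := GRing.isZmodMorphism.Build
  (laurent k) {fraction {poly int}} _ (@laurent_val_zmod_morphism k).
HB.instance Definition _ k := GRing.isMonoidMorphism.Build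
  (laurent k) {fraction {poly int}} _ (@laurent_val_monoid_morphism k).

Lemma Zu_zmod_morphism : zmod_morphism Zu_to_Au.
Proof. by move=> p q; rewrite /Zu_to_Au rmorphB hornerD hornerN. Qed.

Lemma Zu_monoid_morphism : monoid_morphism Zu_to_Au.
Proof.
by split=> [|p q]; rewrite /Zu_to_Au ?rmorph1 ?hornerC // rmorphM hornerM.
Qed.

HB.instance Definition _ :=
  GRing.isZmodMorphism.Build {poly int} Au Zu_to_Au Zu_zmod_morphism.
HB.instance Definition _ :=
  GRing.isMonoidMorphism.Build {poly int} Au Zu_to_Au Zu_monoid_morphism.

Lemma Zu_X : Zu_to_Au 'X = u.
Proof. by rewrite /Zu_to_Au map_polyX hornerX. Qed.

Lemma Zu_C (c : int) : Zu_to_Au c%:P = c%:~R.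
Proof. by rewrite /Zu_to_Au map_polyC hornerC. Qed.

Lemma Zu_MXaddC p c : Zu_to_Au (p * 'X + c%:P) = Zu_to_Au p * u + c%:~R.
Proof. by rewrite rmorphD rmorphM /= Zu_X Zu_C. Qed.

Lemma val_Zu p : laurent_val (Zu_to_Au p) = (map_poly intr p).[vfrac ^+ 2].
Proof.
elim/poly_ind: p => [|p c IHp]; first by rewrite !rmorph0 horner0.
rewrite Zu_MXaddC rmorphD rmorphM /= rmorph_int IHp.
by rewrite [in RHS]rmorphD [in RHS]rmorphM /= map_polyX map_polyC hornerMXaddC.
Qed.

(** Seen in Z[v], the image of [r] is [r] composed with the square of the variable. *)
Lemma Zu_inj : injective Zu_to_Au.
Proof.
move=> p q /(congr1 (@laurent_val 2)); rewrite !val_Zu => e.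
have h (r : {poly int}) :
    (map_poly intr r).[vfrac ^+ 2] = tofrac (r \Po 'X^2).
  elim/poly_ind: r => [|r c IHr].
    by rewrite !rmorph0 horner0 ?comp_poly0 ?rmorph0.
  rewrite rmorphD rmorphM /= map_polyX map_polyC hornerMXaddC IHr.
  rewrite comp_poly_MXaddC [in RHS]rmorphD [in RHS]rmorphM /= rmorphXn.
  congr (_ + _); rewrite /= -{2}[c]intz [in RHS]rmorph_int !rmorph_int //.

move: e; rewrite !h => /eqP; rewrite tofrac_eq -subr_eq0 -comp_polyB.
by rewrite comp_poly_eq0 ?size_polyXn // subr_eq0 => /eqP.
Qed.

Lemma laurent_repr (k : Au) : exists p n, k * u ^+ n = Zu_to_Au p.
Proof.
case: k => x xP; have /asboolP[p [n e]] := xP.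
exists p, n; apply: val_inj.
rewrite [RHS]val_Zu rmorphM rmorphXn /= e mulfVK //.
by rewrite -exprM vfracX_neq0.
Qed.

Lemma laurent_mulfI n (k : laurent n) : k != 0 -> injective ( *%R k).
Proof.
move=> k0 x y /(congr1 val); rewrite !laurent_valM => /mulfI e.
apply: val_inj; apply: e; apply: contra_neq k0 => k0.
by apply: val_inj; rewrite k0.
Qed.

Lemma u_neq0 n : u ^+ n != 0.
Proof.
apply/eqP => e; have := mulrV (unitrX n (laurent_var_unit 2)).
by rewrite e mul0r => /esym/eqP; rewrite oner_eq0.
Qed.

Lemma incl_inj : injective incl.
Proof. by move=> x y /(congr1 val) /= e; apply: val_inj. Qed.

(** * Bar on the Hecke algebra and on its scalars *)

Section Hecke.
Context (W : finGroupType) (S : {set W}) (H : heckeAlgebra S).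
Notation len := (cox_length S).

Lemma hbar_zmod_morphism : zmod_morphism (@hbar W S H).
Proof.
by move=> x y; apply/eqP; rewrite eq_sym subr_eq -hbar_add subrK.
Qed.

Lemma hbar_monoid_morphism : monoid_morphism (@hbar W S H).
Proof. by split; [exact: hbar_1 | exact: hbar_mul]. Qed.

End Hecke.

HB.instance Definition _ (W : finGroupType) (S : {set W})
    (H : heckeAlgebra S) :=
  GRing.isZmodMorphism.Build (hecke_sort H) (hecke_sort H) (@hbar W S H)
    (@hbar_zmod_morphism W S H).
HB.instance Definition _ (W : finGroupType) (S : {set W})
    (H : heckeAlgebra S) :=
  GRing.isMonoidMorphism.Build (hecke_sort H) (hecke_sort H) (@hbar W S H)
    (@hbar_monoid_morphism W S H).

Section HeckeBar.
Context (W : finGroupType) (S : {set W}) (H : heckeAlgebra S).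
Implicit Types (k : Au) (h : H).

Lemma hecke_scalar_inj : injective (fun k => k%:A : H).
Proof.
move=> k k' /= e; apply/eqP; rewrite -subr_eq0; apply/eqP.
have [_ free] := hT_basis H.
have := free (fun i => if i == 1%g then k - k' else 0) _ 1%g (in_setT _).
rewrite eqxx; apply.
rewrite (bigD1 1%g) ?inE //= eqxx big1 => [|i /andP[_ /negPf->]].
  by rewrite hT_1 scalerBl e subrr addr0.
by rewrite scale0r.
Qed.

Lemma hbar_u : hbar (u%:A : H) = u^-1%:A.
Proof.
have := hbar_T H 1 1%g.
by rewrite expr1z invg1 hT_1 invr1 exprN1.
Qed.

Lemma hecke_scalarM k k' : (k * k')%:A = k%:A * k'%:A :> H.
Proof. by rewrite mulr_algl scalerA. Qed.

(** That scalars go to scalars has to be derived: [u T_1] goes to [u^-1 T_1], and every scalar is a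
    polynomial in [u] divided by a power of [u]. *)
Lemma hbar_scalar k : exists k', hbar (k%:A : H) = k'%:A.
Proof.
have poly p : exists k', hbar ((Zu_to_Au p)%:A : H) = k'%:A.
  elim/poly_ind: p => [|p c [k' IHp]].
    by exists 0; rewrite !rmorph0 scale0r rmorph0.
  exists (k' * u^-1 + c%:~R).
  rewrite Zu_MXaddC !scalerDl !hecke_scalarM rmorphD rmorphM /=.
  by rewrite IHp hbar_u !scaler_int rmorph_int.
have [p [n e]] := laurent_repr k; have [k' e'] := poly p.
exists (k' * u ^+ n).
have un : u ^+ n \is a GRing.unit by rewrite unitrX // laurent_var_unit.
have -> : k = Zu_to_Au p * u ^- n by rewrite -e mulrK.
have hun : hbar ((u ^+ n)%:A : H) = (u ^- n)%:A.
  elim: n {e un} => [|n IHn]; first by rewrite expr0 invr1 scale1r rmorph1.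
  rewrite !exprS invrM ?unitrX ?laurent_var_unit // mulrC !hecke_scalarM.
  by rewrite rmorphM /= hbar_u IHn.
rewrite !hecke_scalarM rmorphM /= e'; congr (_ * _).
(* The image of [u ^- n] is determined as the inverse of the image of [u ^+ n]. *)
have : hbar ((u ^+ n)%:A * (u ^- n)%:A : H) = 1.
  by rewrite -hecke_scalarM mulrV // scale1r rmorph1.
rewrite rmorphM /= hun => e1.
set x := hbar _ in e1 *.
have -> : x = (u ^+ n)%:A * (u ^- n)%:A * x.
  by rewrite -hecke_scalarM mulrV // scale1r mul1r.
by rewrite -mulrA e1 mulr1.
Qed.

(** The involution of Z[u, u^-1] exchanging [u] and [u^-1], read off from [hbar] so that it inherits
    the ring morphism laws. *)
Definition lbar k : Au := projT1 (cid (hbar_scalar k)).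

Lemma lbarE k : hbar (k%:A : H) = (lbar k)%:A.
Proof. exact: (projT2 (cid (hbar_scalar k))). Qed.

Lemma lbar_zmod_morphism : zmod_morphism lbar.
Proof.
move=> k k'; apply: hecke_scalar_inj.
by rewrite /= -lbarE scalerBl raddfB /= !lbarE scalerBl.
Qed.

Lemma lbar_monoid_morphism : monoid_morphism lbar.
Proof.
split=> [|k k']; apply: hecke_scalar_inj; rewrite /= -lbarE.
  by rewrite scale1r rmorph1.
by rewrite !hecke_scalarM rmorphM /= !lbarE.
Qed.

Lemma lbar_u : lbar u = u^-1.
Proof. by apply: hecke_scalar_inj; rewrite /= -lbarE hbar_u. Qed.

End HeckeBar.

HB.instance Definition _ (W : finGroupType) (S : {set W})
    (H : heckeAlgebra S) :=
  GRing.isZmodMorphism.Build Au Au (lbar H) (lbar_zmod_morphism H).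
HB.instance Definition _ (W : finGroupType) (S : {set W})
    (H : heckeAlgebra S) :=
  GRing.isMonoidMorphism.Build Au Au (lbar H) (lbar_monoid_morphism H).

Section LaurentBar.
Context (W : finGroupType) (S : {set W}) (H : heckeAlgebra S).

(** Substituting [u^-1] and clearing denominators reverses the coefficients. *)
Lemma lbar_reverse (p : {poly int}) n : (size p <= n.+1)%N ->
  u ^+ n * lbar H (Zu_to_Au p) = Zu_to_Au (\poly_(i < n.+1) p`_(n - i)).
Proof.
move=> sp; have pE : p = \poly_(i < n.+1) p`_i.
  apply/polyP => i; rewrite coef_poly; case: ltnP => // ni.
  by rewrite nth_default // (leq_trans sp).
have zE (E : nat -> int) m :
    Zu_to_Au (\poly_(i < m) E i) = \sum_(i < m) (E i)%:~R * u ^+ i.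
  rewrite poly_def rmorph_sum; apply: eq_bigr => i _ /=.
  by rewrite -mul_polyC rmorphM rmorphXn /= Zu_X Zu_C.
rewrite [in LHS]pE !zE rmorph_sum mulr_sumr (reindex_inj rev_ord_inj) /=.
apply: eq_bigr => i _; rewrite rmorphM rmorphXn rmorph_int /= lbar_u subSS.
rewrite mulrCA; congr (_ * _).
rewrite -{1}(subnK (leq_ord i)) exprD exprVn mulrAC mulrV ?mul1r //.
by rewrite unitrX // laurent_var_unit.
Qed.

(** The equation equates the leading coefficient, at index [deg p], with the coefficient at
    [n - deg p], which lies beyond the degree. *)
Lemma bar_invariant_eq0 (p : {poly int}) n : (2 * (size p).-1 < n)%N ->
  Zu_to_Au p = u ^+ n * lbar H (Zu_to_Au p) -> p = 0.
Proof.
move=> deg; have sp : (size p <= n.+1)%N by move: (size p) deg => k; lia.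
rewrite lbar_reverse // => /Zu_inj e.
apply/eqP; rewrite -lead_coef_eq0 lead_coefE.
have -> := congr1 (fun q : {poly int} => q`_(size p).-1) e; rewrite coef_poly.
by case: ifP => // _; rewrite nth_default //; move: (size p) deg => k; lia.
Qed.

End LaurentBar.

(** * The twisted action of simple reflections *)

Section TwistedAction.
Local Open Scope nat_scope.
Context (W : finGroupType) (S : {set W}) (star : W -> W).
Notation len := (cox_length S).
Notation I := (twisted_involutions star).
Implicit Types (s w : W).

Definition tcomm s w := (s * w == w * star s)%g.
(** The index of the other basis element occurring in [T_s a_w]. *)
Definition tact s w := if tcomm s w then (s * w)%g else (s * w * star s)%g.
Definition tup s w := len w < len (s * w)%g.

Hypotheses (hW : coxeter_system S) (hstar : coxeter_involution S star).
Let genS : (<<S>> = [set: W])%g. Proof. by case: hW. Qed.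
Let ordS s : s \in S -> #[s]%g = 2. Proof. by case: hW => _ + _; apply. Qed.

Lemma simple_mulK s w : s \in S -> (s * (s * w) = w)%g.
Proof. by move=> sS; rewrite mulgA (simpleK ordS) // mul1g. Qed.

Lemma star_mulK s w : s \in S -> (w * star s * star s = w)%g.
Proof.
by move=> sS; rewrite -mulgA (simpleK ordS (star_simple hstar sS)) mulg1.
Qed.

Lemma tact_twisted s w : s \in S -> w \in I -> tact s w \in I.
Proof.
move=> sS wI; rewrite /tact /tcomm.
case: eqP => [e|_]; last exact: (twisted_conj hW hstar).
exact: (twisted_comm hW hstar).
Qed.

Lemma tcomm_tact s w : s \in S -> tcomm s (tact s w) = tcomm s w.
Proof.
move=> sS; rewrite /tact /tcomm.
case: (boolP (s * w == w * star s)%g) => [/eqP e|ne].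
  by apply/eqP; rewrite simple_mulK // e star_mulK.
by rewrite star_mulK // -(mulgA s w) simple_mulK // eq_sym; apply/negbTE.
Qed.

Lemma tactK s w : s \in S -> tact s (tact s w) = w.
Proof.
move=> sS; rewrite {1}/tact tcomm_tact // /tact; case: (tcomm s w).
  exact: simple_mulK.
by rewrite -(mulgA s w) simple_mulK // star_mulK.
Qed.

Lemma tact_len s w : s \in S -> w \in I -> tup s w -> len w < len (tact s w).
Proof.
move=> sS wI up; rewrite /tact /tcomm; case: eqP => // ne.
by rewrite (len_conj hW hstar) //; lia.
Qed.

Lemma tup_tact s w : s \in S -> w \in I -> tup s (tact s w) = ~~ tup s w.
Proof.
move=> sS wI; rewrite /tact /tcomm; case: eqP => [_|ne].
  rewrite /tup simple_mulK //; have := len_simple hW w sS.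
  by move: (len _) (len _) => a b; lia.
have lr := len_mulr_star hW hstar sS wI.
have s'S := star_simple hstar sS.
rewrite /tup -mulgA simple_mulK // lr mulgA.
case: (len_simple hW w sS) => e.
  rewrite (len_conj hW hstar) ?e //.
  by rewrite ltnSn ltnNge leqnSn.
have -> /= : (len w < len (s * w)%g) = false by rewrite e ltnNge leqnSn.
have sws : len (s * w * star s)%g <> len (s * w)%g.
  have := len_simple hW (w * star s)%g sS; rewrite mulgA lr.
  by move: (len _) (len _) => a b; lia.
rewrite ltn_neqAle; apply/andP; split; first exact/eqP.
rewrite leqNgt; apply/negP => lt.
(* If [s * w * star s] were longer than [s * w], then [s * w] would go up on both sides, making
   [w * star s] longer by two than [s * w], whose length it shares. *)
have : len (s * (s * w) * star s)%g = (len (s * w)%g).+2.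
  apply: (len_exchange hW) => //; rewrite simple_mulK ?e // => wE.
  by apply: ne; rewrite {2}wE star_mulK.
by rewrite simple_mulK // lr; move: (len _) => a; lia.
Qed.

End TwistedAction.

(** * Translation by [w0] to the diamond side *)

Section TwistedDiamond.
Local Open Scope nat_scope.
Context (W : finGroupType) (S : {set W}) (star : W -> W).
Hypothesis hW : coxeter_system S.
Notation w0 := (longest S).
Implicit Types (s w : W).

Lemma tcomm_diamond s w :
  tcomm (diamond S star) s (w * w0)%g = tcomm star s w.
Proof.
by rewrite /tcomm (mul_longest_diamond star hW) mulgA (inj_eq (mulIg w0)).
Qed.

Lemma tact_diamond s w :
  tact (diamond S star) s (w * w0)%g = (tact star s w * w0)%g.
Proof.
rewrite /tact tcomm_diamond; case: ifP => _; first by rewrite mulgA.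
by rewrite (mulgA s w) (mul_longest_diamond star hW).
Qed.

Lemma tup_diamond s w : s \in S -> tup S s (w * w0)%g = ~~ tup S s w.
Proof.
move=> sS; rewrite /tup mulgA !(len_mul_longest hW).
have := len_longest S w; have := len_longest S (s * w)%g.
have := len_simple hW w sS.
by move: (cox_length _ _) (cox_length _ _) (cox_length _ _) => a b c; lia.
Qed.

End TwistedDiamond.

Local Notation "k ** m" := (k%:A *: m) (at level 40).

(** * Coordinates and the pairing *)

Section Coordinates.
Context (W : finGroupType) (S : {set W}) (H : heckeAlgebra S) (star : W -> W).
Context (M : involModule H star).
Notation I := (twisted_involutions star).
Notation a := (ma M).
Implicit Types (k : Au) (m : M) (i j w : W).

Lemma hscaleA k k' m : k ** (k' ** m) = (k * k') ** m.
Proof. by rewrite scalerA -hecke_scalarM. Qed.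

Lemma hscaleBl k k' m : (k - k') ** m = k ** m - k' ** m.
Proof. by rewrite !scalerBl. Qed.

Lemma hscale0 m : 0 ** m = 0.
Proof. by rewrite !scale0r. Qed.

Lemma hscale1 m : 1 ** m = m.
Proof. by rewrite !scale1r. Qed.

Lemma hscaleC k (h : H) m : h *: (k ** m) = k ** (h *: m).
Proof. by rewrite !scalerA mulr_algl mulr_algr. Qed.

Lemma mcoord_exists m : exists c : W -> Au, m = \sum_(i in I) c i ** a i.
Proof. by case: (ma_basis M) => + _; apply. Qed.

(** Coefficients outside the twisted involutions are arbitrary in [is_basis]; setting them to 0
    makes coordinates unique. *)
Definition mcoord i m : Au :=
  if i \in I then projT1 (cid (mcoord_exists m)) i else 0.

Lemma mcoord_out i m : i \notin I -> mcoord i m = 0.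
Proof. by rewrite /mcoord => /negPf->. Qed.

Lemma mcoordE m : m = \sum_(i in I) mcoord i m ** a i.
Proof.
rewrite [LHS](projT2 (cid (mcoord_exists m))).
by apply: eq_bigr => i iI; rewrite /mcoord iI.
Qed.

Lemma mcoord_uniq m (c : W -> Au) : m = \sum_(i in I) c i ** a i ->
  forall i, mcoord i m = if i \in I then c i else 0.
Proof.
move=> mE i; case: ifP => iI; last by rewrite mcoord_out ?iI.
have [_ free] := ma_basis M.
apply/eqP; rewrite -subr_eq0; apply/eqP.
apply: (free (fun i => mcoord i m - c i)) => //.
under eq_bigr do rewrite hscaleBl.
by rewrite sumrB -mcoordE -mE subrr.
Qed.

Lemma mcoord_zmod_morphism i : zmod_morphism (mcoord i).
Proof.
move=> m m'; rewrite (@mcoord_uniq _ (fun i => mcoord i m - mcoord i m')).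
  by case: ifP => // iI; rewrite !mcoord_out ?iI ?subr0.
under eq_bigr do rewrite hscaleBl.
by rewrite sumrB -!mcoordE.
Qed.

Lemma mcoordZ i k m : mcoord i (k ** m) = k * mcoord i m.
Proof.
rewrite (@mcoord_uniq _ (fun i => k * mcoord i m)).
  by case: ifP => // iI; rewrite !mcoord_out ?iI ?mulr0.
under eq_bigr do rewrite -hscaleA.
by rewrite -scaler_sumr -mcoordE.
Qed.

Lemma mcoord_ma i j : j \in I -> mcoord i (a j) = (i == j)%:R.
Proof.
move=> jI; rewrite (@mcoord_uniq _ (fun i => (i == j)%:R)).
  by case: ifP => // iI; case: eqP => // e; rewrite e jI in iI.
rewrite (bigD1 j) //= eqxx hscale1 big1 ?addr0 // => i' /andP[_ /negPf->].
exact: hscale0.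
Qed.

Lemma mcoord_ext m m' : (forall i, mcoord i m = mcoord i m') -> m = m'.
Proof.
by move=> e; rewrite (mcoordE m) (mcoordE m'); apply: eq_bigr => i _; rewrite e.
Qed.

Lemma mbar_zmod_morphism : zmod_morphism (@mbar W S H star M).
Proof.
by move=> x y; apply/eqP; rewrite eq_sym subr_eq -mbar_add subrK.
Qed.

End Coordinates.

HB.instance Definition _ W S H star M i := GRing.isZmodMorphism.Build
  (invol_sort M) Au (@mcoord W S H star M i)
  (@mcoord_zmod_morphism W S H star M i).
HB.instance Definition _ W S H star M := GRing.isZmodMorphism.Build
  (invol_sort M) (invol_sort M) (@mbar W S H star M)
  (@mbar_zmod_morphism W S H star M).

Section Action.
Context (W : finGroupType) (S : {set W}) (H : heckeAlgebra S) (star : W -> W).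
Context (M : involModule H star).
Hypotheses (hW : coxeter_system S).
Notation I := (twisted_involutions star).
Notation a := (ma M).
Notation len := (cox_length S).
Implicit Types (k : Au) (m : M) (i j w s : W).

(** Together with [act_off], this packs the four rules for [T_s a_w] into a single formula. *)
Definition act_diag (comm up : bool) : Au :=
  if comm then if up then u else u ^+ 2 - u - 1
  else if up then 0 else u ^+ 2 - 1.

Definition act_off (comm up : bool) : Au :=
  if comm then if up then u + 1 else u ^+ 2 - u
  else if up then 1 else u ^+ 2.

Lemma hT_ma s w : s \in S -> w \in I ->
  hT H s *: a w = act_diag (tcomm star s w) (tup S s w) ** a w
    + act_off (tcomm star s w) (tup S s w) ** a (tact star s w).
Proof.
move=> sS wI; rewrite /tact /act_diag /act_off.
case: (boolP (tup S s w)) => up.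
  have lt : bruhat_lt S w (s * w)%g by rewrite bruhat_simple.
  case: (boolP (tcomm star s w)) => /eqP c; first exact: ma_comm_up.
  by rewrite hscale0 add0r hscale1 ma_ncomm_up.
have lt : bruhat_lt S (s * w)%g w.
  have := bruhat_simple (s * w)%g sS; rewrite (simple_mulK hW) // => ->.
  have := len_simple hW w sS; move: up; rewrite /tup.
  by move: (len _) (len _) => b c; lia.
case: (boolP (tcomm star s w)) => /eqP c; first exact: ma_comm_down.
exact: ma_ncomm_down.
Qed.

Lemma mbarZ k m : mbar (k ** m) = lbar H k ** mbar m.
Proof. by rewrite mbar_act lbarE. Qed.

Lemma hT_simple_inv s : s \in S ->
  (hT H s)^-1 = (u ^- 2) *: hT H s - (1 - u ^- 2)%:A.
Proof.
move=> sS; set T := hT H s; have q := hT_quadratic H sS.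
have u2 : u ^+ 2 \is a GRing.unit by rewrite unitrX // laurent_var_unit.
have TT : T * T = (u ^+ 2 - 1) *: T + (u ^+ 2)%:A.
  apply/eqP; rewrite -subr_eq0 -[X in _ == X]q mulrDl !mulrBr !mul1r mulr_algr.
  rewrite scalerBl scale1r opprD opprB !addrA; apply/eqP.
  by congr (_ - _); rewrite addrAC.
have TV : T * (u ^- 2 *: T - (1 - u ^- 2)%:A) = 1.
  rewrite mulrBr -scalerAr TT scalerDr !scalerA mulrBr mulr1 mulVr //.
  by rewrite mulr_algr addrAC subrr add0r scale1r.
have VT : (u ^- 2 *: T - (1 - u ^- 2)%:A) * T = 1.
  by rewrite -[RHS]TV mulrBr mulrBl -scalerAr -scalerAl mulr_algr mulr_algl.
have TU : T \is a GRing.unit.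
  by apply/unitrP; exists (u ^- 2 *: T - (1 - u ^- 2)%:A).
by apply: (mulrI TU); rewrite mulrV // TV.
Qed.

End Action.

(** * The sign [kappa] *)

Section Kappa.
Context (W : finGroupType) (S : {set W}) (star : W -> W) (phi : W -> nat).
Hypotheses (hW : coxeter_system S) (hstar : coxeter_involution S star).
Hypothesis hphi : is_phi S star phi.
Notation len := (cox_length S).
Implicit Types (s w : W).

Lemma kappa1 : kappa S phi 1%g = 1.
Proof.
have [phi1 _] := hphi; have [genS _ _] := hW.
by rewrite /kappa phi1 (len1 genS).
Qed.

Lemma kappa_sq w : kappa S phi w * kappa S phi w = 1.
Proof. by rewrite -expr2 sqrr_sign. Qed.

(** Going up, [len] and [phi] grow by 1 and 1 in the commuting case, by 2 and 0 otherwise; half of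
    their sum grows by 1 either way. *)
Lemma kappa_tact s w : s \in S -> w \in twisted_involutions star ->
  kappa S phi (tact star s w) = - kappa S phi w.
Proof.
move=> sS wI.
wlog up : w wI / tup S s w.
  move=> h; case: (boolP (tup S s w)) => [|nup]; first exact: h.
  have := h _ (tact_twisted hW hstar sS wI); rewrite (tup_tact hW hstar) //.
  by move=> /(_ nup); rewrite (tactK hW hstar) // => ->; rewrite opprK.
have [_ hphi2] := hphi; have tI := tact_twisted hW hstar sS wI.
have := hphi2 _ s tI sS; have := tup_tact hW hstar sS wI.
have := bruhat_simple (s * tact star s w)%g sS.
rewrite (simple_mulK hW) // => ->.
have := tcomm_tact hW hstar w sS; have := tactK hW hstar w sS.
have := len_simple hW (tact star s w) sS.
rewrite up /tup /= => lc tK tc /negbT; rewrite -leqNgt => le.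
have lt : (len (s * tact star s w)%g < len (tact star s w))%N.
  by move: lc le; move: (len _) (len _) => b c; lia.
move=> /(_ lt) [h1 h2]; rewrite /kappa.
case c : (tcomm star s w) in tc *.
  have e : (s * tact star s w = w)%g by rewrite -[RHS]tK {2}/tact tc.
  have l1 : len (tact star s w) = (len w).+1.
    by move: lc lt; rewrite e; move: (len _) (len _) => b d; lia.
  rewrite l1 (h1 (eqP tc)) e addSn addnS /=.
  by rewrite exprS mulN1r.
have nc : (s * w)%g <> (w * star s)%g.
  by apply/eqP; rewrite -/(tcomm star s w) c.
have e : (s * tact star s w * star s = w)%g by rewrite -[RHS]tK {2}/tact tc.
have tE : tact star s w = (s * w * star s)%g by rewrite /tact c.
rewrite h2 ?e; last by apply/eqP; rewrite -/(tcomm _ _ _) tc.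
by rewrite tE (len_conj hW hstar) // !addSn /= exprS mulN1r.
Qed.

End Kappa.

Section Pairing.
Context (W : finGroupType) (S : {set W}) (star : W -> W).
Context (hW : coxeter_system S) (hstar : coxeter_involution S star).
Context (H : heckeAlgebra S) (M : involModule H star).
Context (Md : involModule H (diamond S star)).
Context (phi : W -> nat) (hphi : is_phi S star phi).
Notation I := (twisted_involutions star).
Notation w0 := (longest S).
Implicit Types (k : Au) (m : M) (n : Md) (i j w s : W).
Let kap w : Au := Zu_to_Au (kappa S phi w).

Definition pair m n : Au :=
  \sum_(t in I) Zu_to_Au (kappa S phi t) * (mcoord t m * mcoord (t * w0)%g n).

Lemma pairDl m m' n : pair (m + m') n = pair m n + pair m' n.
Proof.
rewrite -big_split; apply: eq_bigr => t _ /=.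
by rewrite raddfD mulrDl mulrDr.
Qed.

Lemma pairDr m n n' : pair m (n + n') = pair m n + pair m n'.
Proof.
rewrite -big_split; apply: eq_bigr => t _ /=.
by rewrite raddfD !mulrDr.
Qed.

Lemma pairZl k m n : pair (k ** m) n = k * pair m n.
Proof.
rewrite mulr_sumr; apply: eq_bigr => t _.
by rewrite mcoordZ -mulrA mulrCA.
Qed.

Lemma pairZr k m n : pair m (k ** n) = k * pair m n.
Proof.
rewrite mulr_sumr; apply: eq_bigr => t _.
by rewrite mcoordZ; ring.
Qed.

Lemma pairBr m n n' : pair m (n - n') = pair m n - pair m n'.
Proof. by rewrite -sumrB; apply: eq_bigr => t _; rewrite raddfB !mulrBr. Qed.

Lemma pairBl m m' n : pair (m - m') n = pair m n - pair m' n.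
Proof.
by rewrite -sumrB; apply: eq_bigr => t _; rewrite raddfB mulrBl mulrBr.
Qed.

Lemma pair0l n : pair 0 n = 0.
Proof. by rewrite -(hscale0 (0 : M)) pairZl mul0r. Qed.

Lemma pair0r m : pair m 0 = 0.
Proof. by rewrite -(hscale0 (0 : Md)) pairZr mul0r. Qed.

Lemma pair_suml (J : finType) (P : pred J) (x : J -> M) n :
  pair (\sum_(j | P j) x j) n = \sum_(j | P j) pair (x j) n.
Proof. exact: (big_morph (pair^~ n) (fun x y => pairDl x y n) (pair0l n)). Qed.

Lemma pair_sumr (J : finType) (P : pred J) m (x : J -> Md) :
  pair m (\sum_(j | P j) x j) = \sum_(j | P j) pair m (x j).
Proof. exact: (big_morph (pair m) (fun x y => pairDr m x y) (pair0r m)). Qed.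

Lemma pair_ma_l i n : i \in I -> pair (ma M i) n = kap i * mcoord (i * w0)%g n.
Proof.
move=> iI; rewrite /pair (bigD1 i) //= mcoord_ma // eqxx mul1r.
rewrite big1 ?addr0 // => t /andP[_ ne].
by rewrite mcoord_ma // (negPf ne) mul0r mulr0.
Qed.

Lemma pair_ma_r j m : j \in I -> pair m (ma Md (j * w0)%g) = kap j * mcoord j m.
Proof.
have jd t : t \in I -> (t * w0)%g \in twisted_involutions (diamond S star).
  by rewrite (twisted_longest hW hstar).
move=> jI; rewrite /pair (bigD1 j) //= mcoord_ma ?jd // eqxx mulr1.
rewrite big1 ?addr0 // => t /andP[_ ne].
by rewrite mcoord_ma ?jd // (inj_eq (mulIg w0)) (negPf ne) !mulr0.
Qed.

Lemma mcoordE_longest n :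
  n = \sum_(j in I) mcoord (j * w0)%g n ** ma Md (j * w0)%g.
Proof.
rewrite {1}(mcoordE n) (reindex_inj (mulIg w0)).
by apply: eq_bigl => j; rewrite (twisted_longest hW hstar).
Qed.

(** The operator on the right is [-u^2 T_s^-1]. As translation by [w0] exchanges ascents and
    descents, the diagonal coefficients of [T_s] on the two sides add up to [u^2 - 1]. *)
Lemma pair_hT_ma s i j : s \in S -> i \in I -> j \in I ->
  let n := ma Md (j * w0)%g in
  pair (hT H s *: ma M i) n = pair (ma M i) ((u ^+ 2 - 1) ** n - hT H s *: n).
Proof.
move=> sS iI jI n.
have jd : (j * w0)%g \in twisted_involutions (diamond S star).
  by rewrite (twisted_longest hW hstar).
have tI t : t \in I -> tact star s t \in I by exact: (tact_twisted hW hstar).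
rewrite [in LHS]hT_ma // [in RHS]hT_ma //.
rewrite (tact_diamond star hW) (tcomm_diamond star hW) (tup_diamond hW) //.
rewrite pairDl !pairZl pairBr pairDr !pairZr /n !pair_ma_r ?tI //.
rewrite !mcoord_ma ?tI //.
have tK t := tactK hW hstar t sS.
have neq t : t \in I -> (t == tact star s t) = false.
  move=> tI'; apply/eqP => e; have := tup_tact hW hstar sS tI'.
  by rewrite -e; case: (tup S s t).
have [->|ne] := eqVneq j i.
  rewrite neq // eq_sym neq // /act_diag.
  case: (tcomm _ _ _); case: (tup _ _ _) => /=; ring.
(* Both [tact] and the translation by [w0] flip the ascent, so the same [act_off] occurs on both
   sides; [kappa] supplies the sign. *)
have [->|ne'] := eqVneq j (tact star s i).
  rewrite (tup_tact hW hstar) // (tcomm_tact hW hstar) // tK eqxx negbK.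
  by rewrite /kap (kappa_tact hW hstar hphi) // rmorphN /=; ring.
have -> : (tact star s j == i) = false.
  by apply/eqP => e; rewrite -e tK eqxx in ne'.
by rewrite !mulr0 addr0 subrr.
Qed.

End Pairing.

(** * Canonical elements and triangularity of bar *)

Section Canonical.
Context (W : finGroupType) (S : {set W}) (H : heckeAlgebra S) (star : W -> W).
Context (M : involModule H star) (E : extModule M) (P : W -> W -> {poly int}).
Notation I := (twisted_involutions star).
Notation len := (cox_length S).
Implicit Types (k : Au) (m : M) (i j w x y : W).

(** This is [A_w] without its factor [v^-l(w)], so that it already lives in M. *)
Definition canonM w : M :=
  \sum_(y in I | bruhat S y w) Zu_to_Au (P y w) ** ma M y.

Lemma canonM_coord w i : mcoord i (canonM w) =
  if (i \in I) && bruhat S i w then Zu_to_Au (P i w) else 0.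
Proof.
rewrite (@mcoord_uniq _ _ _ _ _ _
  (fun i => if bruhat S i w then Zu_to_Au (P i w) else 0)).
  by case: ifP.
rewrite /canonM big_mkcondr; apply: eq_bigr => y _ /=.
by case: ifP => // _; rewrite hscale0.
Qed.

Lemma canonical_eltE w :
  canonical_elt E P w = v ^ (- (len w)%:Z) *: ext_in E (canonM w).
Proof.
have [extD extZ] := ext_in_semilinear E.
have ext0 : ext_in E 0 = 0.
  by apply: (addrI (ext_in E 0)); rewrite -extD !addr0.
rewrite /canonical_elt /canonM (big_morph (ext_in E) extD ext0).
by congr (_ *: _); apply: eq_bigr => y _; rewrite extZ.
Qed.

(** The universal property applied to a coordinate form with values in Z[v, v^-1] lets coordinates
    be read in the extension. *)
Lemma ext_in_eq m m' (k k' : Av) : k *: ext_in E m = k' *: ext_in E m' ->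
  forall i, k * incl (mcoord i m) = k' * incl (mcoord i m').
Proof.
move=> e i; pose f m0 : Av^o := incl (mcoord i m0).
have fS : semilinear_Au f.
  split=> [x y|c x]; rewrite /f; first by rewrite !raddfD.
  by rewrite mcoordZ rmorphM.
have [g [gE _]] := ext_univ E fS.
by have /(congr1 g) := e; rewrite !linearZ /= !gE.
Qed.

Lemma canonM_bar w : is_Psigma E P -> w \in I ->
  u ^+ len w ** mbar (canonM w) = canonM w.
Proof.
move=> hP /hP[barE _ _]; move: barE; rewrite canonical_eltE ebar_in opprK.
move=> /ext_in_eq e; apply: mcoord_ext => i; rewrite mcoordZ.
apply: incl_inj; rewrite rmorphM rmorphXn /= incl_u.
have := congr1 ( *%R (v ^+ len w)) (e i).
rewrite !mulrA -exprnN divrr ?mul1r ?unitrX ?laurent_var_unit // => <-.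
by rewrite -exprnP -expr2 -!exprM mulnC.
Qed.

(** In [canonM_bar] the terms with [y < w] vanish at [x] by induction, [y] being shorter than [x],
    and only the bar of [a_w] remains. The existence of the polynomials replaces a computation of
    the bar operator. *)
Lemma mbar_triangular : is_Psigma E P -> forall w x, w \in I -> x \in I ->
  (len w <= len x)%N -> u ^+ len w * mcoord x (mbar (ma M w)) = (x == w)%:R.
Proof.
move=> hP w; have [n] := ubnP (len w); elim: n w => // n IHn w ltn x wI xI le.
have := congr1 (mcoord x) (canonM_bar hP wI); have [_ Pww _] := hP _ wI.
have ww : bruhat S w w by exact: connect0.
rewrite mcoordZ canonM_coord xI /= /canonM.
rewrite (bigD1 w) ?wI ?ww //= Pww rmorph1 hscale1 raddfD /= raddfD /=.
rewrite (_ : mcoord x (mbar (\sum_(i | _) _)) = 0) ?addr0.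
  move=> ->; have [->|ne] := eqVneq x w; first by rewrite ww Pww rmorph1.
  case: ifP => // /bruhat_len[e|]; first by rewrite e eqxx in ne.
  by rewrite ltnNge le.
rewrite !raddf_sum big1 // => y /andP[/andP[yI yw] ne] /=.
have lt : (len y < len w)%N.
  by have [e|//] := bruhat_len yw; rewrite e eqxx in ne.
rewrite mbarZ mcoordZ.
suff -> : mcoord x (mbar (ma M y)) = 0 by rewrite mulr0.
have := IHn y _ x yI xI _; rewrite (_ : (x == y) = false); last first.
  by apply/eqP => e; move: le; rewrite e leqNgt lt.
rewrite (leq_trans (ltnW lt) le) (leq_trans lt _) // => h.
by apply: (laurent_mulfI (k := u ^+ len y)); rewrite ?h ?mulr0 // u_neq0.
Qed.

End Canonical.

(** * Compatibility of the pairing with bar *)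

Section BarPairing.
Context (W : finGroupType) (S : {set W}) (star : W -> W).
Context (hW : coxeter_system S) (hstar : coxeter_involution S star).
Context (H : heckeAlgebra S) (M : involModule H star).
Context (Md : involModule H (diamond S star)) (Ed : extModule Md).
Context (phi : W -> nat) (hphi : is_phi S star phi).
Context (Pd : W -> W -> {poly int}) (hPd : is_Psigma Ed Pd).
Notation I := (twisted_involutions star).
Notation w0 := (longest S).
Notation len := (cox_length S).
Notation pair := (pair phi).
Implicit Types (k : Au) (m : M) (n : Md) (i j w s : W).

Lemma pair_hT s m n : s \in S ->
  pair (hT H s *: m) n = pair m ((u ^+ 2 - 1) ** n - hT H s *: n).
Proof.
move=> sS.
have basis i : i \in I -> pair (hT H s *: ma M i) n
    = pair (ma M i) ((u ^+ 2 - 1) ** n - hT H s *: n).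
  move=> iI; rewrite (mcoordE_longest hW hstar n) !scaler_sumr -sumrB.
  rewrite !pair_sumr.
  apply: eq_bigr => j jI.
  rewrite (hscaleC _ (hT H s)) (hscaleC _ (u ^+ 2 - 1)%:A) -scalerBr.
  by rewrite !pairZr (pair_hT_ma hW hstar _ _ hphi).
rewrite (mcoordE m) scaler_sumr !pair_suml; apply: eq_bigr => i iI.
by rewrite (hscaleC _ (hT H s)) !pairZl basis.
Qed.

Let twd w : ((w * w0)%g \in twisted_involutions (diamond S star)) = (w \in I).
Proof. exact: twisted_longest. Qed.

(** No index is longer than [w0], so triangularity kills every term except the one at [w0]. *)
Lemma mcoord_longest_bar n :
  u ^+ len w0 * mcoord w0 (mbar n) = lbar H (mcoord w0 n).
Proof.
have w0I : w0 \in twisted_involutions (diamond S star).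
  by rewrite -[w0]mul1g twd (twisted1 hstar).
rewrite {1}(mcoordE n) !raddf_sum (bigD1 w0) //= big1 => [|i /andP[iI ne]].
  rewrite addr0 mbarZ mcoordZ mulrCA (mbar_triangular hPd) // eqxx.
  by rewrite mulr1.
rewrite mbarZ mcoordZ.
suff -> : mcoord w0 (mbar (ma Md i)) = 0 by rewrite mulr0.
have := mbar_triangular hPd iI w0I (len_longest S i).
rewrite eq_sym (negPf ne) => h.
by apply: (laurent_mulfI (k := u ^+ len i)); rewrite ?h ?mulr0 // u_neq0.
Qed.

(** The [m] that satisfy this for all [n] are closed under sums, scalars and every [T_s], and
    include [a_1]; each other [a_w] is reached from the shorter [tact s w]. *)
Lemma pair_bar m n :
  u ^+ len w0 * pair (mbar m) (mbar n) = lbar H (pair m n).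
Proof.
have [genS ordS _] := hW.
pose Q m := forall n,
  u ^+ len w0 * pair (mbar m) (mbar n) = lbar H (pair m n).
have QD x y : Q x -> Q y -> Q (x + y).
  by move=> Qx Qy n'; rewrite raddfD /= !pairDl mulrDr Qx Qy rmorphD.
have QZ k x : Q x -> Q (k ** x).
  by move=> Qx n'; rewrite mbarZ !pairZl mulrCA Qx rmorphM.
have QB x y : Q x -> Q y -> Q (x - y).
  move=> Qx Qy; rewrite -[y]hscale1 -scaleNr -[- _]scaleNr; apply: QD => //.
  exact: QZ.
have QT s x : s \in S -> Q x -> Q (hT H s *: x).
  move=> sS Qx n'; rewrite pair_hT // -Qx.
  (* The exponent 0 in [hbar_T] shows that the bar of [T_s] is its inverse. *)
  have hb : hbar (hT H s) = u ^- 2 *: hT H s - (1 - u ^- 2)%:A.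
    have := hbar_T H 0 s; rewrite !expr0z !scale1r => ->.
    by rewrite (simpleV ordS) // hT_simple_inv.
  have hz (V : lmodType H) (z : V) : hbar (hT H s) *: z
      = u ^- 2 ** (hT H s *: z) - (1 - u ^- 2) ** z.
    by rewrite hb scalerBl scalerA mulr_algl.
  rewrite [mbar (hT H s *: x)]mbar_act hz pairBl !pairZl pair_hT //.
  rewrite raddfB /= mbarZ [mbar (hT H s *: n')]mbar_act hz !pairBr !pairZr.
  rewrite rmorphB rmorphXn rmorph1 /= lbar_u exprVn.
  have uV : u ^- 2 * u ^+ 2 = 1 by rewrite mulVr // unitrX // laurent_var_unit.
  congr (_ * _); rewrite mulrBr mulrA mulrBr mulr1 uV; ring.
have Qcancel k x : lbar H k != 0 -> Q (k ** x) -> Q x.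
  move=> k0 h n'; have := h n'; rewrite mbarZ !pairZl mulrCA rmorphM.
  by move/(laurent_mulfI k0).
have Q1 : Q (ma M 1%g).
  move=> n'; rewrite mbar_a1 !pair_ma_l ?(twisted1 hstar) //.
  rewrite (kappa1 hW hphi) rmorph1 !mul1r mul1g; exact: mcoord_longest_bar.
suff Qa w : w \in I -> Q (ma M w).
  rewrite (mcoordE m); apply: (big_ind Q) => // [|i iI]; last exact/QZ/Qa.
  by rewrite -(hscale0 (ma M 1%g)); apply: QZ.
have [l] := ubnP (len w); elim: l w => // l IHl w ltl wI.
case e : (len w) => [|d]; first by rewrite (len0 genS e).
have [s [x [sS wE xd]]] := len_split genS e.
have sK : (s * w = x)%g by rewrite wE (simple_mulK hW).
have nup : tup S s w = false by rewrite /tup sK e xd ltnNge leqnSn.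
have tI := tact_twisted hW hstar sS wI.
have tup' : tup S s (tact star s w) by rewrite (tup_tact hW hstar) // nup.
have lt := tact_len hW hstar sS tI tup'; rewrite (tactK hW hstar) // in lt.
have Qt : Q (ma M (tact star s w)) by apply: IHl => //; apply: leq_trans lt _.
(* Going up from [tact s w], the element [a_w] appears with coefficient 1 or [u + 1], which is then
   cancelled. *)
have := QT s _ sS Qt; rewrite hT_ma // (tactK hW hstar) // tup'.
set c := tcomm star s (tact star s w) => QTt.
have := QB _ _ QTt (QZ (act_diag c true) _ Qt).
rewrite addrAC subrr add0r; apply: Qcancel.
rewrite /act_off; case: ifP => _; last by rewrite rmorph1 oner_neq0.
(* The bar of [u + 1] is nonzero: multiplied by [u] it becomes [1 + u], a polynomial of size 2. *)
apply/eqP => /(congr1 ( *%R u)); rewrite rmorphD rmorph1 /= lbar_u mulr0.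
rewrite mulrDr mulr1 divrr ?laurent_var_unit // -Zu_X.
rewrite -(rmorph1 Zu_to_Au) -rmorphD -(rmorph0 Zu_to_Au) => /Zu_inj.
move/(congr1 (fun p : {poly int} => size p)).
by rewrite addrC size_XaddC size_poly0.
Qed.

End BarPairing.

(** * Inversion *)

Section Inversion.
Context (W : finGroupType) (S : {set W}) (star : W -> W).
Context (hW : coxeter_system S) (hstar : coxeter_involution S star).
Context (H : heckeAlgebra S) (M : involModule H star) (E : extModule M).
Context (Md : involModule H (diamond S star)) (Ed : extModule Md).
Context (P Pd : W -> W -> {poly int}).
Context (hP : is_Psigma E P) (hPd : is_Psigma Ed Pd).
Context (phi : W -> nat) (hphi : is_phi S star phi).
Notation I := (twisted_involutions star).
Notation w0 := (longest S).
Notation len := (cox_length S).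
Implicit Types (t w y z : W).

(** Up to signs, an entry of the product of the two matrices in the order opposite to the
    theorem. *)
Definition inv_sum z w : {poly int} :=
  \sum_(t in I | bruhat S z t && bruhat S t w)
    kappa S phi t * (P t w * Pd (t * w0)%g (z * w0)%g).

Lemma pair_canonM z w :
  pair phi (canonM M P w) (canonM Md Pd (z * w0)%g) = Zu_to_Au (inv_sum z w).
Proof.
rewrite /pair /inv_sum big_mkcondr rmorph_sum; apply: eq_bigr => t tI /=.
rewrite !canonM_coord (twisted_longest hW hstar) tI (bruhat_mul_longest hW) /=.
case: (bruhat S z t); case: (bruhat S t w);
  rewrite /= ?mul0r ?mulr0 ?rmorph0 //.
by rewrite !rmorphM.
Qed.

(** The canonical elements contribute the exponents [len w] and [len w0 - len z], and [pair_bar]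
    absorbs [len w0]. *)
Lemma inv_sum_bar z w : z \in I -> w \in I -> (len z <= len w)%N ->
  Zu_to_Au (inv_sum z w)
  = u ^+ (len w - len z) * lbar H (Zu_to_Au (inv_sum z w)).
Proof.
move=> zI wI le; rewrite -pair_canonM -(pair_bar hW hstar hphi hPd).
rewrite -{1}(canonM_bar hP wI).
rewrite -{1}(canonM_bar hPd (w := (z * w0)%g)); last first.
  by rewrite (twisted_longest hW hstar).
rewrite pairZl pairZr !mulrA -!exprD (len_mul_longest hW).
congr (_ ^+ _ * _); have := len_longest S z; move: le.
by move: (len _) (len _) (len _) => a b c; lia.
Qed.

(** The boolean merges the diagonal case, of degree 0, with the strict bound. *)
Lemma Psigma_deg t w : t \in I -> w \in I -> bruhat S t w ->
  (2 * (size (P t w)).-1 <= len w - len t - (t != w))%N.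
Proof.
move=> tI wI tw; have [_ Pww deg] := hP wI; have [->|ne] := eqVneq t w.
  by rewrite Pww size_poly1.
by apply: deg => //; apply/andP.
Qed.

Lemma Psigma_diamond_deg z t : z \in I -> t \in I -> bruhat S z t ->
  (2 * (size (Pd (t * w0)%g (z * w0)%g)).-1 <= len t - len z - (z != t))%N.
Proof.
move=> zI tI zt; have zd := twisted_longest hW hstar z.
have td := twisted_longest hW hstar t; rewrite tI in td; rewrite zI in zd.
have [_ Pzz deg] := hPd zd; have [->|ne] := eqVneq z t.
  have [_ -> _] := hPd td; by rewrite size_poly1.
have := deg (t * w0)%g td; rewrite /bruhat_lt (bruhat_mul_longest hW) zt andbT.
rewrite (inj_eq (mulIg w0)) eq_sym ne => /(_ isT).
rewrite !(len_mul_longest hW).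
have := len_longest S z; have := len_longest S t.
by move: (len _) (len _) (len _) (size _) => a b c d; lia.
Qed.

(** As [z != w], each [t] differs from [z] or from [w]. At least one of the two degree bounds is
    therefore strict, and so is their sum. *)
Lemma inv_sum_deg z w : z \in I -> w \in I -> z != w -> bruhat S z w ->
  (2 * (size (inv_sum z w)).-1 < len w - len z)%N.
Proof.
move=> zI wI ne zw.
have lt : (len z < len w)%N by apply: bruhat_lt_len; apply/andP.
pose d := ((len w - len z).-1 %/ 2)%N.
suff le : (size (inv_sum z w) <= d.+1)%N.
  move: le lt; rewrite /d; move: (size _) (len _) (len _) => a b c; lia.
apply: (leq_trans (size_sum _ _ _)).
apply/bigmax_leqP => t /andP[tI /andP[zt tw]].
rewrite /kappa size_Msign; apply: (leq_trans (size_polyMleq _ _)).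
have := Psigma_deg tI wI tw; have := Psigma_diamond_deg zI tI zt.
(* This keeps the truncated subtractions in both bounds exact. *)
have le x y : bruhat S x y -> (len x + (x != y) <= len y)%N.
  case/bruhat_len => [->|lt']; first by rewrite eqxx addn0.
  by apply: leq_trans lt'; rewrite -addn1 leq_add2l leq_b1.
have nn : ((t != w) + (z != t) >= 1)%N.
  by have [->|//] := eqVneq t w; rewrite ne.
move: nn (le _ _ tw) (le _ _ zt) lt; rewrite /d.
move: (len _) (len _) (len _) (size _) (size _) (nat_of_bool _) (nat_of_bool _).
move=> a b c p q e f; lia.
Qed.

Lemma inv_sum_delta z w : z \in I -> w \in I ->
  inv_sum z w = if z == w then kappa S phi w else 0.
Proof.
move=> zI wI; have [->|ne] := eqVneq z w.
  have [_ Pww _] := hP wI.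
  have [_ Pdww _] := hPd (etrans (twisted_longest hW hstar w) wI).
  have ww : bruhat S w w by exact: connect0.
  rewrite /inv_sum (bigD1 w) ?wI ?ww //= Pww Pdww !mulr1 big1 ?addr0 // => t.
  case/andP => /andP[_ /andP[wt tw]] ne.
  have [e|lt] := bruhat_len wt; first by rewrite e eqxx in ne.
  have [e|lt'] := bruhat_len tw; first by rewrite e eqxx in ne.
  by have := ltn_trans lt lt'; rewrite ltnn.
case: (boolP (bruhat S z w)) => [zw|nzw].
  apply: (bar_invariant_eq0 (inv_sum_deg zI wI ne zw)).
  apply: inv_sum_bar => //; apply/ltnW/bruhat_lt_len; exact/andP.
rewrite /inv_sum big1 // => t /andP[_ /andP[zt tw]].
by case/negP: nzw; apply: connect_trans zt tw.
Qed.

(** A left inverse of a square matrix over a commutative ring is a right inverse. Both signs are put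
    into [B], so that the product known from [inv_sum_delta] is exactly the identity. *)
Lemma Psigma_inverse y w : y \in I -> w \in I ->
  \sum_(t in I | bruhat S y t && bruhat S t w)
    P y t * (kappa S phi t * (kappa S phi w * Pd (w * w0)%g (t * w0)%g))
  = (y == w)%:R.
Proof.
move=> yI wI; set n := #|I|.
pose e (i : 'I_n) : W := enum_val i.
have eI i : e i \in I by exact: enum_valP.
pose A : 'M[{poly int}]_n :=
  \matrix_(i, j) (if bruhat S (e i) (e j) then P (e i) (e j) else 0).
pose B : 'M[{poly int}]_n :=
  \matrix_(i, j) (if bruhat S (e i) (e j) then kappa S phi (e i) *
    (kappa S phi (e j) * Pd (e j * w0)%g (e i * w0)%g) else 0).
have BA : B *m A = 1%:M.
  apply/matrixP => i k; rewrite !mxE.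
  transitivity (kappa S phi (e i) * inv_sum (e i) (e k)).
    rewrite /inv_sum mulr_sumr big_mkcondr [RHS]big_enum_val /=.
    apply: eq_bigr => j _; rewrite !mxE -/(e j).
    case: (bruhat S (e i) _); case: (bruhat S _ (e k));
      rewrite /= ?mulr0 ?mul0r //; ring.
  rewrite inv_sum_delta // (inj_eq enum_val_inj).
  by case: eqP => [->|]; rewrite ?kappa_sq ?mulr0.
pose iy := enum_rank_in yI y; pose iw := enum_rank_in yI w.
have ey : e iy = y by exact: enum_rankK_in.
have ew : e iw = w by exact: enum_rankK_in.
have := congr1 (fun X : 'M_n => X iy iw) (mulmx1C BA); rewrite !mxE.
rewrite -(inj_eq enum_val_inj) -/(e _) -/(e _) ey ew => <-.
rewrite big_mkcondr [LHS]big_enum_val /=; apply: eq_bigr => j _.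
rewrite !mxE -/(e j) ey ew.
by case: (bruhat S y _); case: (bruhat S _ w); rewrite /= ?mulr0 ?mul0r.
Qed.

End Inversion.

Theorem theorem7p7 (W : finGroupType) (S : {set W}) (star : W -> W)
    (hW : coxeter_system S) (hstar : coxeter_involution S star)
    (H : heckeAlgebra S)
    (M : involModule H star) (E : extModule M)
    (Md : involModule H (diamond S star)) (Ed : extModule Md)
    (P Pd : W -> W -> {poly int})
    (hP : is_Psigma E P) (hPd : is_Psigma Ed Pd)
    (phi : W -> nat) (hphi : is_phi S star phi)
    (y w : W) (hy : y \in twisted_involutions star)
    (hw : w \in twisted_involutions star) (hyw : bruhat S y w) :
  \sum_(t in twisted_involutions star | bruhat S y t && bruhat S t w)
     kappa S phi y * kappa S phi t * P y t
       * Pd (w * longest S)%g (t * longest S)%g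
  = (y == w)%:R.
Proof.
(* The inverse matrix carries the sign of [w] instead of that of [y]; the two agree on the diagonal,
   and elsewhere the right-hand side is 0. *)
transitivity (kappa S phi y * kappa S phi w * (y == w)%:R); last first.
  by case: eqP => [->|_]; rewrite ?mulr0 // kappa_sq mulr1.
rewrite -(Psigma_inverse hW hstar hP hPd hphi hy hw) mulr_sumr.
apply: eq_bigr => t _; transitivity (kappa S phi y * kappa S phi t * P y t
  * Pd (w * longest S)%g (t * longest S)%g * (kappa S phi w * kappa S phi w)).
  by rewrite kappa_sq mulr1.
ring.
Qed.
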